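(* Let $\mathbb{F}_1,\dots,\mathbb{F}_t$ be finite fields. Then $R=\mathbb{F}_1\times\cdots\times\mathbb{F}_t$ is a ring with representations.
   Context: All rings are commutative with unit. Kernel of a pair: for $R$-linear maps (or matrices over $R[z]$) $f_1:M_1\to N$ and $f_2:M_2\to N$, put $\mathrm{Ker}(f_1\mid f_2):=\{m_2\in M_2 : \exists m_1\in M_1,\ f_1(m_1)+f_2(m_2)=0\}$. Convolutional codes: for $k\le n$, an $(n,k)$ convolutional code over $R$ is a free $R[z]$-submodule $\mathfrak{C}\subset R[z]^n$ of rank $k$ such that $R[z]^n/\mathfrak{C}$ is flat over $R$. For a prime $\mathfrak{p}$ of $R$ with residue field $k(\mathfrak{p})$, $\mathfrak{C}(\mathfrak{p}):=\mathfrak{C}\otimes_R k(\mathfrak{p})$ is then a rank $k$ submodule of $k(\mathfrak{p})[z]^n$; its degree is the highest degree of the $k\times k$ minors of any $n\times k$ matrix over $k(\mathfrak{p})[z]$ whose columns generate $\mathfrak{C}(\mathfrak{p})$. The degree of $\mathfrak{C}$ is the function $\mathrm{Spec}(R)\to\mathbb{N}$, $\mathfrak{p}\mapsto \deg\mathfrak{C}(\mathfrak{p})$. Standing assumption: all codes considered have constant degree function, with value denoted $\delta$. First order representations: a first order representation of an $(n,k)$ code $\mathfrak{C}$ of degree $\delta$ over $R$ is a triple $(K,L,M)$ with $K,L\in \mathrm{Mat}_{(\delta+n-k)\times\delta}(R)$, $M\in \mathrm{Mat}_{(\delta+n-k)\times n}(R)$ and $\mathfrak{C}=\mathrm{Ker}(zK+L\mid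 M)=\{v(z)\in R[z]^n:\exists x(z)\in R[z]^\delta,\ (zK+L)x(z)+Mv(z)=0\}$. It is minimal if: (1) $K:R^\delta\to R^{\delta+n-k}$ is injective with $R$-flat cokernel; (2) $(K,M):R^{\delta+n}\to R^{\delta+n-k}$ is surjective; (3) $(zK+L,M):R[z]^{\delta+n}\to R[z]^{\delta+n-k}$ is surjective. Two representations $(K,L,M)$, $(K',L',M')$ are equivalent if there are invertible matrices $T\in GL_{\delta+n-k}(R)$, $S\in GL_\delta(R)$ with $(K',L',M')=(TKS^{-1},TLS^{-1},TM)$. A commutative ring $R$ is a ring with representations if every convolutional code over $R$ (of constant degree) has a minimal first order representation, unique up to equivalence. *)

(* Defs.v *)
From HB Require Import structures.
From mathcomp Require Import all_boot all_order all_algebra.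
From mathcomp Require Import boolp.

Set Implicit Arguments.
Unset Strict Implicit.
Unset Printing Implicit Defensive.

Import GRing.Theory.
Local Open Scope ring_scope.

Section QuotientModule.
Variables (A : nzRingType) (V : lmodType A) (N : submodClosed V).

Definition zsub : {pred V} := N.

Fact zsub_zmod_closed : zmod_closed zsub.
Proof.
split=> [|u v Nu Nv]; first exact: (rpred0 N).
by rewrite -scaleN1r; apply: (rpredD (Nu : u \in N)); apply: rpredZ.
Qed.
HB.instance Definition _ := GRing.isZmodClosed.Build V zsub zsub_zmod_closed.

Definition quotmod : Type := Quotient.quot zsub.
HB.instance Definition _ := GRing.Zmodule.on quotmod.

Definition quotmod_proj (v : V) : quotmod := \pi_(Quotient.quot zsub)%qT v.

Definition quotmod_scale (a : A) (q : quotmod) : quotmod :=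
  quotmod_proj (a *: repr (q : Quotient.quot zsub)).

Fact quotmod_projP u v : reflect (quotmod_proj u = quotmod_proj v) (u - v \in N).
Proof.
have -> : (u - v \in N) = (u == v %[mod Quotient.quot zsub])%qT.
  by rewrite -Quotient.idealrBE.
exact: eqP.
Qed.

Fact quotmod_projK (q : quotmod) :
  quotmod_proj (repr (q : Quotient.quot zsub)) = q.
Proof. exact: reprK. Qed.

Fact quotmod_projD : {morph quotmod_proj : u v / u + v}.
Proof. by move=> u v; exact: (raddfD (\pi_(Quotient.quot zsub)%qT)). Qed.

Fact quotmod_projZ a v : quotmod_scale a (quotmod_proj v) = quotmod_proj (a *: v).
Proof.
apply/quotmod_projP; rewrite -scalerBr; apply: rpredZ.
by apply/quotmod_projP; rewrite quotmod_projK.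
Qed.

Fact quotmod_scaleA a b q :
  quotmod_scale a (quotmod_scale b q) = quotmod_scale (a * b) q.
Proof. by rewrite -(quotmod_projK q) !quotmod_projZ scalerA. Qed.
Fact quotmod_scale1 : left_id 1 quotmod_scale.
Proof. by move=> q; rewrite -(quotmod_projK q) quotmod_projZ scale1r. Qed.
Fact quotmod_scaleDr : right_distributive quotmod_scale +%R.
Proof.
move=> a p q; rewrite -(quotmod_projK p) -(quotmod_projK q).
by rewrite -quotmod_projD !quotmod_projZ scalerDr quotmod_projD.
Qed.
Fact quotmod_scaleDl q : {morph quotmod_scale^~ q : a b / a + b}.
Proof.
move=> a b; rewrite -(quotmod_projK q).
by rewrite !quotmod_projZ scalerDl quotmod_projD.
Qed.
HB.instance Definition _ := GRing.Zmodule_isLmodule.Build A quotmod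
  quotmod_scaleA quotmod_scale1 quotmod_scaleDr quotmod_scaleDl.
End QuotientModule.

Definition restr_scalars (A B : nzRingType) (phi : {rmorphism A -> B})
  (M : lmodType B) : Type := M.

Section RestrictionOfScalars.
Variables (A B : nzRingType) (phi : {rmorphism A -> B}) (M : lmodType B).

HB.instance Definition _ := GRing.Zmodule.on (restr_scalars phi M).
Local Notation restr_scalars := (restr_scalars phi M).

Definition restr_scale (a : A) (x : restr_scalars) : restr_scalars :=
  phi a *: (x : M).

Fact restr_scaleA a b x : restr_scale a (restr_scale b x) = restr_scale (a * b) x.
Proof. by rewrite /restr_scale scalerA rmorphM. Qed.
Fact restr_scale1 : left_id 1 restr_scale.
Proof. by move=> x; rewrite /restr_scale rmorph1 scale1r. Qed.
Fact restr_scaleDr : right_distributive restr_scale +%R.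
Proof. by move=> a x y; exact: scalerDr. Qed.
Fact restr_scaleDl x : {morph restr_scale^~ x : a b / a + b}.
Proof. by move=> a b; rewrite /restr_scale rmorphD scalerDl. Qed.
HB.instance Definition _ := GRing.Zmodule_isLmodule.Build A restr_scalars
  restr_scaleA restr_scale1 restr_scaleDr restr_scaleDl.
End RestrictionOfScalars.

(* The tensor product of A and M over R is [seq (A * M)] modulo [tensor_eq]:
   the sequence [:: (a1, m1); ...; (ar, mr)] stands for the element
   a1 (x) m1 + ... + ar (x) mr. *)
Inductive tensor_eq (R : comNzRingType) (A M : lmodType R) :
    seq (A * M) -> seq (A * M) -> Prop :=
| TensorRefl s : tensor_eq s s
| TensorSym s t : tensor_eq s t -> tensor_eq t s
| TensorTrans s t u : tensor_eq s t -> tensor_eq t u -> tensor_eq s u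
| TensorCat s s' t t' :
    tensor_eq s s' -> tensor_eq t t' -> tensor_eq (s ++ t) (s' ++ t')
| TensorC s t : tensor_eq (s ++ t) (t ++ s)
| Tensor0 m : tensor_eq [:: (0, m)] [::]
| TensorDl a b m : tensor_eq [:: (a + b, m)] [:: (a, m); (b, m)]
| TensorDr a m n : tensor_eq [:: (a, m + n)] [:: (a, m); (a, n)]
| TensorZ c a m : tensor_eq [:: (c *: a, m)] [:: (a, c *: m)].

Definition flat (R : comNzRingType) (M : lmodType R) : Prop :=
  forall (A B : lmodType R) (f : {linear A -> B}), injective f ->
  forall s t : seq (A * M),
    tensor_eq [seq (f x.1, x.2) | x <- s] [seq (f x.1, x.2) | x <- t] ->
    tensor_eq s t.

Section MatrixMaps.
Variable R : comNzRingType.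

Definition mx_injective m n (A : 'M[R]_(m, n)) : Prop :=
  injective (fun x : 'cV[R]_n => A *m x).

Definition mx_surjective m n (A : 'M[R]_(m, n)) : Prop :=
  forall y : 'cV[R]_m, exists x : 'cV[R]_n, A *m x = y.

Definition mx_inverse n (A B : 'M[R]_n) : Prop :=
  A *m B = 1%:M /\ B *m A = 1%:M.

Definition mx_image m n (A : 'M[R]_(m, n)) : {pred 'cV[R]_m} :=
  fun v => `[< exists x : 'cV[R]_n, v = A *m x >].

Fact mx_image_closed m n (A : 'M[R]_(m, n)) : submod_closed (mx_image A).
Proof.
split=> [|a u v /asboolP[x ->] /asboolP[y ->]]; apply/asboolP.
  by exists 0; rewrite mulmx0.
by exists (a *: x + y); rewrite mulmxDr scalemxAr.
Qed.
HB.instance Definition _ m n (A : 'M[R]_(m, n)) :=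
  GRing.isSubmodClosed.Build R 'cV[R]_m (mx_image A) (mx_image_closed A).

Definition mx_coker m n (A : 'M[R]_(m, n)) : lmodType R := quotmod (mx_image A).

Definition pair_ker m n1 n2 (f1 : 'M[R]_(m, n1)) (f2 : 'M[R]_(m, n2))
    (v : 'cV[R]_n2) : Prop :=
  exists x : 'cV[R]_n1, f1 *m x + f2 *m v = 0.
End MatrixMaps.

Section ResidueField.
Variables (R : comNzRingType) (p : prime_idealr R).

Definition residue_ring : Type := {ideal_quot p}.
HB.instance Definition _ := GRing.ComNzRing.on residue_ring.

(* [{fraction _}] requires an integral domain with a decidable unit predicate. *)
Definition residue_unit : {pred residue_ring} := fun x => `[< exists y, y * x = 1 >].
Definition residue_inv (x : residue_ring) : residue_ring :=
  if pselect (exists y, y * x = 1) is left e then projT1 (cid e) else x.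

Fact residue_mulVx : {in residue_unit, left_inverse 1 residue_inv *%R}.
Proof.
move=> x /asboolP xu; rewrite /residue_inv.
by case: pselect => // e; case: cid.
Qed.
Fact residue_unitP x y : y * x = 1 -> residue_unit x.
Proof. by move=> yx; apply/asboolP; exists y. Qed.
Fact residue_inv_out : {in [predC residue_unit], residue_inv =1 id}.
Proof.
move=> x /asboolP xu; rewrite /residue_inv.
by case: pselect.
Qed.
HB.instance Definition _ := GRing.ComNzRing_hasMulInverse.Build residue_ring
  residue_mulVx residue_unitP residue_inv_out.
HB.instance Definition _ := GRing.ComUnitRing_isIntegral.Build residue_ring
  (@Quotient.rquot_IdomainAxiom R p).

Definition residue_field : fieldType := {fraction residue_ring}.

Definition to_residue (a : R) : residue_field :=
  tofrac (\pi_{ideal_quot p}%qT a : residue_ring).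
End ResidueField.

Section Codes.
Variable R : comNzRingType.

Definition free_of_rank (S : comNzRingType) n k (C : {pred 'cV[S]_n}) : Prop :=
  exists2 G : 'M[S]_(n, k), mx_injective G & C =i mx_image G.

Definition conv_code n k (C : submodClosed 'cV[{poly R}]_n) : Prop :=
  [/\ (k <= n)%N, free_of_rank k C
    & flat (restr_scalars (polyC : {rmorphism R -> {poly R}}) (quotmod C))].

(* The image in k(p)[z]^n of the tensor product of C with k(p), to which that
   tensor product is isomorphic because R[z]^n / C is flat over R; an element
   (c, a) of the sequence stands for the tensor c (x) a. *)
Definition code_at n (C : {pred 'cV[{poly R}]_n}) (p : prime_idealr R)
    (w : 'cV[{poly residue_field p}]_n) : Prop :=
  exists2 s : seq ('cV[{poly R}]_n * residue_field p),
    {in s, forall x, x.1 \in C}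
    & w = \sum_(x <- s) x.2%:P *: map_mx (map_poly (to_residue p)) x.1.
End Codes.

(* A k x k minor of an n x k matrix is indexed by a strictly increasing choice
   of rows.  A zero minor counts for 0 in the maximum, which is harmless as a
   matrix generating a submodule of rank k has a nonzero k x k minor. *)
Definition max_minor_degree (K : fieldType) n k (G : 'M[{poly K}]_(n, k)) : nat :=
  \max_(f : {ffun 'I_k -> 'I_n}
         | [forall i : 'I_k, forall j : 'I_k, (i < j)%N ==> (f i < f j)%N])
    (size (\det (rowsub f G))).-1.

Definition poly_module_degree (K : fieldType) n (k : nat)
    (D : 'cV[{poly K}]_n -> Prop) (d : nat) : Prop :=
  exists2 G : 'M[{poly K}]_(n, k),
    (forall w, D w <-> w \in mx_image G) & max_minor_degree G = d.

Definition constant_degree (R : comNzRingType) n (k : nat)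
    (C : {pred 'cV[{poly R}]_n}) (delta : nat) : Prop :=
  forall p : prime_idealr R, poly_module_degree k (code_at C (p := p)) delta.

(* The truncated subtraction in [delta + n - k] is exact: codes have k <= n. *)
Section Representations.
Variables (R : comNzRingType) (n k delta : nat).
Local Notation r := (delta + n - k)%N.

Definition pencil (K L : 'M[R]_(r, delta)) : 'M[{poly R}]_(r, delta) :=
  'X *: map_mx polyC K + map_mx polyC L.

Definition first_order_rep (C : {pred 'cV[{poly R}]_n})
    (K L : 'M[R]_(r, delta)) (M : 'M[R]_(r, n)) : Prop :=
  forall v, v \in C <-> pair_ker (pencil K L) (map_mx polyC M) v.

Definition minimal_rep (C : {pred 'cV[{poly R}]_n})
    (K L : 'M[R]_(r, delta)) (M : 'M[R]_(r, n)) : Prop :=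
  [/\ first_order_rep C K L M,
      mx_injective K /\ flat (mx_coker K),
      mx_surjective (row_mx K M)
    & mx_surjective (row_mx (pencil K L) (map_mx polyC M))].

Definition equivalent_rep (K L : 'M[R]_(r, delta)) (M : 'M[R]_(r, n))
    (K' L' : 'M[R]_(r, delta)) (M' : 'M[R]_(r, n)) : Prop :=
  exists (T Tinv : 'M[R]_r) (S Sinv : 'M[R]_delta),
    [/\ mx_inverse T Tinv, mx_inverse S Sinv,
        K' = T *m K *m Sinv, L' = T *m L *m Sinv & M' = T *m M].
End Representations.

Definition ring_with_representations (R : comNzRingType) : Prop :=
  forall (n k delta : nat) (C : submodClosed 'cV[{poly R}]_n),
    conv_code k C -> constant_degree k C delta ->
    (exists (K L : 'M[R]_(delta + n - k, delta)) (M : 'M[R]_(delta + n - k, n)),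
       minimal_rep C K L M)
    /\ (forall (K L K' L' : 'M[R]_(delta + n - k, delta))
          (M M' : 'M[R]_(delta + n - k, n)),
          minimal_rep C K L M -> minimal_rep C K' L' M' ->
          equivalent_rep K L M K' L' M').

(* The index type has t + 1 elements because a [comNzRingType] is nonzero. *)
Section ProductRing.
Variables (t : nat) (F : 'I_t.+1 -> comNzRingType).

Definition prod_ring : Type := {dffun forall i, F i}.
HB.instance Definition _ := Choice.on prod_ring.

Implicit Types x y : prod_ring.

Definition prod_zero : prod_ring := [ffun i => 0 : F i].
Definition prod_one : prod_ring := [ffun i => 1 : F i].
Definition prod_opp x : prod_ring := [ffun i => - x i].
Definition prod_add x y : prod_ring := [ffun i => x i + y i].
Definition prod_mul x y : prod_ring := [ffun i => x i * y i].

Fact prod_addA : associative prod_add.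
Proof. by move=> x y z; apply/ffunP=> i; rewrite !ffunE addrA. Qed.
Fact prod_addC : commutative prod_add.
Proof. by move=> x y; apply/ffunP=> i; rewrite !ffunE addrC. Qed.
Fact prod_add0 : left_id prod_zero prod_add.
Proof. by move=> x; apply/ffunP=> i; rewrite !ffunE add0r. Qed.
Fact prod_addN : left_inverse prod_zero prod_opp prod_add.
Proof. by move=> x; apply/ffunP=> i; rewrite !ffunE addNr. Qed.
HB.instance Definition _ := GRing.isZmodule.Build prod_ring
  prod_addA prod_addC prod_add0 prod_addN.

Fact prod_mulA : associative prod_mul.
Proof. by move=> x y z; apply/ffunP=> i; rewrite !ffunE mulrA. Qed.
Fact prod_mulC : commutative prod_mul.
Proof. by move=> x y; apply/ffunP=> i; rewrite !ffunE mulrC. Qed.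
Fact prod_mul1 : left_id prod_one prod_mul.
Proof. by move=> x; apply/ffunP=> i; rewrite !ffunE mul1r. Qed.
Fact prod_mulDl : left_distributive prod_mul prod_add.
Proof. by move=> x y z; apply/ffunP=> i; rewrite !ffunE mulrDl. Qed.
Fact prod_one_neq0 : prod_one != prod_zero.
Proof. by apply/eqP=> /ffunP/(_ ord0)/eqP; rewrite !ffunE oner_eq0. Qed.
HB.instance Definition _ := GRing.Zmodule_isComNzRing.Build prod_ring
  prod_mulA prod_mulC prod_mul1 prod_mulDl prod_one_neq0.
End ProductRing.

(* Main.v *)
Require Import Defs.
From HB Require Import structures.
From mathcomp Require Import all_boot all_order all_algebra.
From mathcomp Require Import perm boolp.

Set Implicit Arguments.
Unset Strict Implicit.
Unset Printing Implicit Defensive.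

Import GRing.Theory.
Local Open Scope ring_scope.

(** Let [C] be the code generated by the injective matrix [G] over [R[z]].  Let
    [D] be the set of all z^-N (v - low), where v is in [C] and low is the part
    of v of degree less than N; it contains [C].  The quotient [D / C] is the
    state space of the code, and every minimal first order representation is a
    description of it in coordinates.  Precisely, let [E = D + R^n].  As a
    vector d of [D] is z times another vector of [D] plus a constant vector, and
    as z D is contained in [E], there are three maps into [E / C]: the inclusion
    of [D / C], minus the multiplication by z on [D / C], and the map from
    constant vectors.  Their matrices are K, L and M.  A trajectory x of a
    codeword v has as coefficients the successive truncations of v, up to sign,
    and [(z K + L) x + M v = 0] says that each truncation is z times the next
    one plus a coefficient of v.

    Existence: [realization] is this description with a polynomial matrix [Y]
    whose columns represent a basis of [E / C].  [exists_realization] builds it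
    from a basis [X] of [D / C], and the lemmas [rz_first_order], [rz_surj_KM]
    and [rz_surj_pencil] show that it gives a minimal representation.  The sizes
    are right when [D / C] is free of rank delta: then [E / C] has rank
    [delta + n - k], because [E] is the direct sum of R^n and z D, so that
    [E / z C] has rank [delta + n], and [C / z C] has rank k.

    Uniqueness: in a minimal representation, the right inverse of
    [(z K + L, M)] contains a matrix [Y] which maps R^r into R[z]^n / C, r being
    the number of equations, so that the images of R^r and K R^delta do not
    depend on the representation: they are [E / C] and [D / C]
    ([minimal_rep_observer]).  The two identifications with these modules give
    the matrices T and S ([minimal_rep_unique]).

    Both parts use of the ring [R] only that the image of an injective matrix
    over [R] has a free complement of the expected rank
    ([complemented_injections]), and of the code that [D / C] has a basis of
    delta elements ([state_basis]).  Both properties hold for a product of rings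
    as soon as they hold for the factors.  Over a field the first one is Gaussian
    elimination.  For the second one, replace [G] by a column reduced matrix with
    column degrees nu_j; the polynomial parts of z^-i g_j, for 0 < i <= nu_j
    and g_j the j-th column, form a basis of [D / C], by the predictable degree
    property, and the sum of the nu_j is the highest degree of the maximal
    minors, that is the degree of the code. *)

(** * Matrices, congruences and truncation *)

Local Notation cst := (map_mx polyC).

Lemma mx_injectiveP (S : comNzRingType) m n (A : 'M[S]_(m, n)) :
  (forall x : 'cV_n, A *m x = 0 -> x = 0) -> mx_injective A.
Proof.
move=> A0 x y /= /eqP; rewrite -subr_eq0 -mulmxBr => /eqP/A0/eqP.
by rewrite subr_eq0 => /eqP.
Qed.

Lemma mx_injective0 (S : comNzRingType) m n p (A : 'M[S]_(m, n))
    (B : 'M[S]_(n, p)) : mx_injective A -> A *m B = 0 -> B = 0.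
Proof.
move=> Ainj AB0; apply/matrixP=> i j; rewrite mxE.
have /Ainj/matrixP/(_ i 0): A *m col j B = A *m 0.
  by rewrite mulmx0 -[RHS](col0 _ _ j) -AB0 !colE mulmxA.
by rewrite !mxE.
Qed.

Lemma mx_choice (S : nzRingType) p m (P : 'I_m -> 'cV[S]_p -> Prop) :
  (forall j, exists x, P j x) -> exists A : 'M_(p, m), forall j, P j (col j A).
Proof.
move=> /choice[f fP]; exists (\matrix_(i, j) f j i 0) => j.
suff ->: col j (\matrix_(i, j) f j i 0) = f j by [].
by apply/matrixP=> i l; rewrite !mxE ord1.
Qed.

Lemma col_eq_mx (T : Type) m n (A B : 'M[T]_(m, n)) :
  (forall j, col j A = col j B) -> A = B.
Proof.
move=> e; apply/matrixP=> i j.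
by have /matrixP/(_ i 0) := e j; rewrite !mxE.
Qed.

Lemma mx_surjectiveP (S : comNzRingType) m n (A : 'M[S]_(m, n)) :
  mx_surjective A <-> exists B, A *m B = 1%:M.
Proof.
split=> [As | [B AB1] y]; last by exists (B *m y); rewrite mulmxA AB1 mul1mx.
have [B AB] := mx_choice (fun j => As (col j 1%:M)).
by exists B; apply: col_eq_mx => j; rewrite -AB !colE !mulmxA.
Qed.

(** Two matrices are congruent when their columns are equal modulo the column
    module of [G]; all matrix identities in R[z]^n / C are stated in this form. *)
Section Congruence.
Variables (S : comNzRingType) (n k : nat) (G : 'M[S]_(n, k)).

Definition congr_mod m (A B : 'M[S]_(n, m)) := exists U, A = B + G *m U.

Lemma congr_refl m (A : 'M_(n, m)) : congr_mod A A.
Proof. by exists 0; rewrite mulmx0 addr0. Qed.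

Lemma congr_sym m (A B : 'M_(n, m)) : congr_mod A B -> congr_mod B A.
Proof. by move=> [U ->]; exists (- U); rewrite mulmxN addrK. Qed.

Lemma congr_trans m (B A C : 'M_(n, m)) :
  congr_mod A B -> congr_mod B C -> congr_mod A C.
Proof. by move=> [U ->] [V ->]; exists (V + U); rewrite mulmxDr addrA. Qed.

Lemma congrD m (A B A' B' : 'M_(n, m)) :
  congr_mod A B -> congr_mod A' B' -> congr_mod (A + A') (B + B').
Proof. by move=> [U ->] [V ->]; exists (U + V); rewrite mulmxDr addrACA. Qed.

Lemma congrN m (A B : 'M_(n, m)) : congr_mod A B -> congr_mod (- A) (- B).
Proof. by move=> [U ->]; exists (- U); rewrite mulmxN opprD. Qed.

Lemma congrZ m (A B : 'M_(n, m)) a :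
  congr_mod A B -> congr_mod (a *: A) (a *: B).
Proof. by move=> [U ->]; exists (a *: U); rewrite scalerDr scalemxAr. Qed.

Lemma congrMr m p (A B : 'M_(n, m)) (C : 'M_(m, p)) :
  congr_mod A B -> congr_mod (A *m C) (B *m C).
Proof. by move=> [U ->]; exists (U *m C); rewrite mulmxDl mulmxA. Qed.

Lemma congr_im m (U : 'M_(k, m)) : congr_mod (G *m U) 0.
Proof. by exists U; rewrite add0r. Qed.
End Congruence.

Section Shift.
Variable R : comNzRingType.

(** [dropmx N A] is the polynomial part of z^-N A. *)
Definition dropmx N m n (A : 'M[{poly R}]_(m, n)) := map_mx (drop_poly N) A.
Definition coefmx i m n (A : 'M[{poly R}]_(m, n)) := map_mx (coefp i) A.

Lemma dropmxD N m n (A B : 'M_(m, n)) :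
  dropmx N (A + B) = dropmx N A + dropmx N B.
Proof. by apply/matrixP=> i j; rewrite !mxE drop_polyD. Qed.

Lemma dropmx0 N m n : dropmx N (0 : 'M[{poly R}]_(m, n)) = 0.
Proof. by apply/matrixP=> i j; rewrite !mxE drop_poly0r. Qed.

Lemma drop0mx m n (A : 'M_(m, n)) : dropmx 0 A = A.
Proof. by apply/matrixP=> i j; rewrite !mxE drop_poly0l. Qed.

Lemma dropmx_drop M N m n (A : 'M_(m, n)) :
  dropmx M (dropmx N A) = dropmx (M + N) A.
Proof.
apply/matrixP=> i j; rewrite !mxE; apply/polyP=> l.
by rewrite !coef_drop_poly addnA.
Qed.

Lemma dropmx_eventually0 m n (A : 'M_(m, n)) : exists N, dropmx N A = 0.
Proof.
exists (\max_i \max_j size (A i j)); apply/matrixP=> i j; rewrite !mxE.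
apply/drop_poly_eq0/(leq_trans _ (leq_bigmax i)).
exact: (leq_bigmax (F := fun j => size (A i j)) j).
Qed.

Lemma dropmx_mulC N m n p (A : 'M_(m, n)) (c : 'M_(n, p)) :
  dropmx N (A *m cst c) = dropmx N A *m cst c.
Proof.
apply/matrixP=> i j; rewrite !mxE drop_poly_sum; apply: eq_bigr => l _.
by rewrite !mxE mulrC mul_polyC drop_polyZ -mul_polyC mulrC.
Qed.

Lemma dropmx_mulCl N m n p (c : 'M_(m, n)) (A : 'M_(n, p)) :
  dropmx N (cst c *m A) = cst c *m dropmx N A.
Proof.
apply/matrixP=> i j; rewrite !mxE drop_poly_sum; apply: eq_bigr => l _.
by rewrite !mxE mul_polyC drop_polyZ -mul_polyC.
Qed.

Lemma dropmx_Xn N m n (A : 'M_(m, n)) : dropmx N ('X^N *: A) = A.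
Proof. by apply/matrixP=> i j; rewrite !mxE mulrC drop_polyMXn_id. Qed.

Lemma dropmxSX N m n (A : 'M_(m, n)) : dropmx N.+1 ('X *: A) = dropmx N A.
Proof.
apply/matrixP=> i j; rewrite !mxE; apply/polyP=> l.
by rewrite !coef_drop_poly coefXM addnS.
Qed.

Lemma dropmx_split m n (A : 'M_(m, n)) :
  A = 'X *: dropmx 1 A + cst (coefmx 0 A).
Proof.
apply/matrixP=> i j; rewrite !mxE; apply/polyP=> -[|l].
  by rewrite coefD coefXM coefC add0r.
by rewrite coefD coefXM coefC addr0 coef_drop_poly addn1.
Qed.

Lemma dropmx_X N m n (A : 'M_(m, n)) :
  exists c, dropmx N ('X *: A) = 'X *: dropmx N A + cst c.
Proof.
case: N => [|N]; first by exists 0; rewrite !drop0mx map_mx0 addr0.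
rewrite dropmxSX; exists (coefmx 0 (dropmx N A)).
by rewrite {1}[dropmx N A]dropmx_split dropmx_drop.
Qed.

Lemma X_cst_inj m n (A B : 'M[{poly R}]_(m, n)) (c d : 'M[R]_(m, n)) :
  'X *: A + cst c = 'X *: B + cst d -> A = B /\ c = d.
Proof.
move=> e; split; apply/matrixP=> i j; have /matrixP/(_ i j) := e;
  rewrite !mxE => /polyP e'.
  by apply/polyP=> l; have := e' l.+1; rewrite !coefD !coefXM !coefC !addr0.
by have := e' 0; rewrite !coefD !coefXM !coefC !add0r.
Qed.

Lemma dropmx_cst N m n (c : 'M[R]_(m, n)) : dropmx N.+1 (cst c) = 0.
Proof.
apply/matrixP=> i j; rewrite !mxE; apply/drop_poly_eq0.
by apply: leq_trans (size_polyC_leq1 _) _.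
Qed.
End Shift.

(** * State spaces and realizations *)

Section StateSpace.
Variables (R : comNzRingType) (n k delta : nat).
Variable G : 'M[{poly R}]_(n, k).

Definition const_free s (Z : 'M[{poly R}]_(n, s)) : Prop :=
  forall m (x : 'M[R]_(s, m)) A, Z *m cst x = G *m A -> x = 0.

Lemma const_free_eq s (Z : 'M[{poly R}]_(n, s)) m (x y : 'M[R]_(s, m)) :
  const_free Z -> congr_mod G (Z *m cst x) (Z *m cst y) -> x = y.
Proof.
move=> Zfree [U /(canLR (addKr _)) e]; apply/eqP; rewrite -subr_eq0.
by apply/eqP/(Zfree _ _ U); rewrite -e map_mxB mulmxBr addrC.
Qed.

(** The state space of the code [C] spanned by [G] is [D / C], where [D] is the
    set of all vectors obtained from a codeword by deleting its lowest
    coefficients and dividing by a power of z: what the past of a codeword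
    transmits to its future.  The columns of [X] are representatives of a basis
    of [D / C] over [R].  The last field, which says that they are in [D], is
    in a single equation because [dropmx N (G *m V)] does not change when [N]
    grows and [V] is multiplied by the same power of z. *)
Record state_basis (X : 'M[{poly R}]_(n, delta)) : Prop := StateBasis {
  state_free : const_free X;
  state_gen : forall m N (A : 'M_(k, m)),
    exists x : 'M[R]_(delta, m), congr_mod G (dropmx N (G *m A)) (X *m cst x);
  state_drop : exists N V, X = dropmx N (G *m V) }.

Variable X : 'M[{poly R}]_(n, delta).
Hypothesis Xbasis : state_basis X.

(** A vector X x and an element of [C] have a sum in [D]: both are
    truncations of codewords at the same place, after multiplication of the
    second one by a power of z. *)
Lemma congr_state_drop m (v : 'M_(n, m)) (x : 'M_(delta, m)) :
  congr_mod G v (X *m cst x) -> exists N A, v = dropmx N (G *m A).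
Proof.
have [N [V ->]] := state_drop Xbasis; case=> U ->.
exists N, (V *m cst x + 'X^N *: U); rewrite mulmxDr dropmxD mulmxA.
by rewrite dropmx_mulC -scalemxAr dropmx_Xn.
Qed.

Lemma congr_state_eq m (x y : 'M_(delta, m)) :
  congr_mod G (X *m cst x) (X *m cst y) -> x = y.
Proof. exact/const_free_eq/(state_free Xbasis). Qed.

Lemma shift_state m (v : 'M_(n, m)) (x : 'M_(delta, m)) :
  congr_mod G v (X *m cst x) ->
  exists x' : 'M_(delta, m), congr_mod G (dropmx 1 v) (X *m cst x').
Proof.
move=> /congr_state_drop[N [A ->]].
by rewrite dropmx_drop; apply: (state_gen Xbasis).
Qed.

Lemma shift_code m (A : 'M_(k, m)) :
  exists x : 'M_(delta, m), congr_mod G (dropmx 1 (G *m A)) (X *m cst x).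
Proof. exact: (state_gen Xbasis). Qed.

(** z D is contained in [D + R^n]: multiplying by z undoes one step of a
    truncation, up to the coefficient which that step has removed. *)
Lemma X_state : exists (x : 'M_delta) (c : 'M_(n, delta)),
  congr_mod G ('X *: X) (X *m cst x + cst c).
Proof.
have [N [V eX]] := state_drop Xbasis.
have [c ec] := dropmx_X N (G *m V).
have [x ex] := state_gen Xbasis N ('X *: V).
exists x, (- c); rewrite map_mxN.
have ->: 'X *: X = dropmx N (G *m ('X *: V)) - cst c.
  by rewrite -scalemxAr ec -eX addrK.
by apply: congrD ex _; apply: congr_refl.
Qed.

Local Notation r := (delta + n - k)%N.

(** The columns of [Y] represent a basis of [E / C]; K, L and M are the matrices
    of the inclusion of [D / C], of minus the multiplication by z, and of the map
    from constant vectors. *)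
Record realization (Y : 'M[{poly R}]_(n, r)) (K L : 'M[R]_(r, delta))
    (M : 'M[R]_(r, n)) : Prop := Realization {
  rz_free : const_free Y;
  rz_K : congr_mod G (Y *m cst K) X;
  rz_L : congr_mod G (Y *m cst L) (- ('X *: X));
  rz_M : congr_mod G (Y *m cst M) 1%:M }.

Section RealizationTheory.
Variables (Y : 'M[{poly R}]_(n, r)) (K L : 'M[R]_(r, delta)) (M : 'M[R]_(r, n)).
Hypothesis rYKLM : realization Y K L M.

Lemma rz_eq m (x y : 'M_(r, m)) :
  congr_mod G (Y *m cst x) (Y *m cst y) -> x = y.
Proof. exact/const_free_eq/(rz_free rYKLM). Qed.

Lemma rz_K_eq m (x : 'M_(delta, m)) :
  congr_mod G (Y *m cst (K *m x)) (X *m cst x).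
Proof. by rewrite map_mxM mulmxA; apply: congrMr (rz_K rYKLM). Qed.

Lemma rz_L_eq m (x : 'M_(delta, m)) :
  congr_mod G (Y *m cst (L *m x)) (- ('X *: (X *m cst x))).
Proof.
by rewrite map_mxM mulmxA scalemxAl -mulNmx; apply: congrMr (rz_L rYKLM).
Qed.

Lemma rz_M_eq m (c : 'M_(n, m)) : congr_mod G (Y *m cst (M *m c)) (cst c).
Proof.
rewrite map_mxM mulmxA -[X in congr_mod _ _ X]mul1mx.
exact: congrMr (rz_M rYKLM).
Qed.

Lemma rz_K_inj m (x : 'M_(delta, m)) : K *m x = 0 -> x = 0.
Proof.
move=> Kx0; apply: congr_state_eq; apply: congr_trans (congr_sym (rz_K_eq x)) _.
by rewrite Kx0 !map_mx0 !mulmx0; apply: congr_refl.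
Qed.

(** The trajectory of a vector v in [D] that represents the state x: writing
    v = z v' + c, where v' is again in [D] and represents a state x', gives
    K x = M c - L x'.  The induction goes on with v', which has lower degree.
    For x = 0 this solves the equation of the representation; for v = X x it
    shows that K x is in the image of [(z K + L, M)]. *)
Lemma pencil_solve m (v : 'M_(n, m)) (x : 'M_(delta, m)) :
  congr_mod G v (X *m cst x) ->
  exists xi, pencil K L *m xi + cst M *m v = cst (K *m x).
Proof.
have [N] := dropmx_eventually0 v; elim: N v x => [|N IHN] v x v0 vx.
  exists 0; rewrite -[v]drop0mx v0 !mulmx0 addr0.
  suff ->: x = 0 by rewrite mulmx0 map_mx0.
  apply: congr_state_eq; apply: congr_trans (congr_sym vx) _.
  by rewrite -[v]drop0mx v0 map_mx0 mulmx0; apply: congr_refl.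
have [x' vx'] := shift_state vx.
have [|xi exi] := IHN _ x' _ vx'; first by rewrite dropmx_drop addn1.
have eKx : K *m x = M *m coefmx 0 v - L *m x'.
  apply: rz_eq; apply: congr_trans (rz_K_eq x) _.
  apply: congr_trans (congr_sym vx) _; rewrite [v in congr_mod _ v _]dropmx_split.
  rewrite map_mxB mulmxBr addrC; apply: congrD.
    exact/congr_sym/rz_M_eq.
  apply/congr_sym/(congr_trans (congrN (rz_L_eq x'))); rewrite opprK.
  exact/congrZ/congr_sym.
exists ('X *: xi - cst x').
rewrite mulmxBr {1}[v]dropmx_split mulmxDr -!scalemxAr addrACA -scalerDr exi.
rewrite eKx map_mxB !map_mxM /pencil mulmxDl -scalemxAl.
by rewrite opprD -!addrA addNKr addrC.
Qed.

Lemma pencil_Y : congr_mod G (Y *m pencil K L) 0.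
Proof.
rewrite mulmxDr -scalemxAr -[0](subrr ('X *: X)).
exact: congrD (congrZ _ (rz_K rYKLM)) (rz_L rYKLM).
Qed.

Lemma rz_first_order (v : 'cV_n) :
  v \in mx_image G <-> pair_ker (pencil K L) (cst M) v.
Proof.
split=> [/asboolP[a ->] | [x ev]].
  have [|xi] := @pencil_solve _ (G *m a) 0.
    by rewrite map_mx0 mulmx0; apply: congr_im.
  by rewrite mulmx0 map_mx0; exists xi.
suff [U eU] : congr_mod G v 0 by apply/asboolP; exists U; rewrite eU add0r.
rewrite -[v]mul1mx; apply: congr_trans (congr_sym (congrMr _ (rz_M rYKLM))) _.
rewrite -[X in congr_mod _ _ X](mulmx0 _ Y) -ev mulmxDr !mulmxA.
rewrite -[X in congr_mod _ X _]add0r; apply: congrD (congr_refl _ _).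
by rewrite -[X in congr_mod _ X _](mul0mx _ x); apply/congr_sym/congrMr/pencil_Y.
Qed.

(** As [E] is both [z D + R^n] (surjectivity of [(L, M)]) and [D + R^n]
    (lemma [X_state]), surjectivity passes from one pair to the other. *)
Lemma rz_surj_KM : (exists P, row_mx L M *m P = 1%:M) ->
  mx_surjective (row_mx K M).
Proof.
case=> P; rewrite -[P]vsubmxK mul_row_col.
set x := usubmx P; set c := dsubmx P => LMP1; apply/mx_surjectiveP.
have [x' [c' ex']] := X_state.
exists (col_mx (- (x' *m x)) (c - c' *m x)).
rewrite mul_row_col -LMP1; apply/rz_eq.
rewrite 2!map_mxD.
rewrite [Y *m (_ + _)]mulmxDr [X in congr_mod _ _ X]mulmxDr.
apply: congr_trans (congrD (rz_K_eq _) (rz_M_eq _)) _.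
apply/congr_sym/(congr_trans (congrD (rz_L_eq _) (rz_M_eq _))).
rewrite map_mxN mulmxN map_mxB addrCA addrC; apply: congrD; last exact: congr_refl.
rewrite addrC -opprD; apply/congrN.
by rewrite !map_mxM mulmxA -mulmxDl scalemxAl; apply: congrMr; rewrite addrC.
Qed.

Lemma rz_surj_pencil : mx_surjective (row_mx K M) ->
  mx_surjective (row_mx (pencil K L) (cst M)).
Proof.
move=> /mx_surjectiveP[P]; rewrite -[P]vsubmxK mul_row_col.
set x := usubmx P; set c := dsubmx P => KMP1; apply/mx_surjectiveP.
have [xi exi] := pencil_solve (congr_refl G (X *m cst x)).
exists (col_mx xi (X *m cst x + cst c)).
rewrite mul_row_col mulmxDr addrA exi -map_mxM -map_mxD KMP1 map_mx1 //.
Qed.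
End RealizationTheory.
End StateSpace.

(** * Flatness of the cokernel of a split injection *)

Section Flatness.
Variable R : comNzRingType.

Lemma tensor_eq_map (A M N : lmodType R) (g : M -> N) (s t : seq (A * M)) :
    {morph g : x y / x + y} -> (forall c, {morph g : x / c *: x}) ->
  tensor_eq s t ->
  tensor_eq [seq (x.1, g x.2) | x <- s] [seq (x.1, g x.2) | x <- t].
Proof.
move=> gD gZ; elim=> {s t} /=.
- by move=> s; apply: TensorRefl.
- by move=> s t _; apply: TensorSym.
- by move=> s t u _ st _; apply: TensorTrans.
- by move=> s s' t t' _ ss' _ tt'; rewrite !map_cat; apply: TensorCat.
- by move=> s t; rewrite !map_cat; apply: TensorC.
- by move=> m; apply: Tensor0.
- by move=> a b m; apply: TensorDl.
- by move=> a m p; rewrite gD; apply: TensorDr.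
- by move=> c a m; rewrite gZ; apply: TensorZ.
Qed.

(** A section and a retraction transport tensors forth and back, naturally in
    the other factor. *)
Lemma flat_retract (M N : lmodType R) (sec : M -> N) (ret : N -> M) :
    {morph sec : x y / x + y} -> (forall c, {morph sec : x / c *: x}) ->
    {morph ret : x y / x + y} -> (forall c, {morph ret : x / c *: x}) ->
  cancel sec ret -> flat N -> flat M.
Proof.
move=> secD secZ retD retZ secK flatN A B f finj s t fst.
have reK (u : seq (A * M)) :
    [seq (x.1, ret x.2) | x <- [seq (x.1, sec x.2) | x <- u]] = u.
  by rewrite -map_comp -[RHS]map_id; apply: eq_map => -[a m] /=; rewrite secK.
rewrite -[s]reK -[t]reK; apply: tensor_eq_map => //; apply: (flatN _ _ f finj).
by have := tensor_eq_map secD secZ fst; rewrite -!map_comp.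
Qed.

Section FreeModule.
Variables (A : lmodType R) (m : nat).
Implicit Types (s t : seq (A * 'cV[R]_m)) (a : 'I_m -> A).

Definition tensor_coord s i := \sum_(x <- s) x.2 i 0 *: x.1.

Definition of_coord a (l : seq 'I_m) : seq (A * 'cV[R]_m) :=
  [seq (a i, delta_mx i 0) | i <- l].

Lemma tensor_coordP s t : tensor_eq s t -> tensor_coord s =1 tensor_coord t.
Proof.
rewrite /tensor_coord; elim=> {s t} /=.
- by [].
- by move=> s t _ e i.
- by move=> s t u _ e _ e' i; rewrite e.
- by move=> s s' t t' _ e _ e' i; rewrite !big_cat /= e e'.
- by move=> s t i; rewrite !big_cat /= addrC.
- by move=> v i; rewrite big_seq1 big_nil scaler0.
- by move=> a b v i; rewrite !big_cons !big_nil /= !addr0 scalerDr.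
- by move=> a u v i; rewrite !big_cons !big_nil /= !addr0 mxE scalerDl.
- by move=> c a v i; rewrite !big_seq1 /= mxE scalerA mulrC.
Qed.

Lemma of_coordD a b l :
  tensor_eq (of_coord (fun i => a i + b i) l) (of_coord a l ++ of_coord b l).
Proof.
elim: l => [|i l IHl] /=; first exact: TensorRefl.
apply: TensorTrans (TensorCat (TensorDl _ _ _) IHl) _.
have swap (x y : A * 'cV[R]_m) s t :
  tensor_eq ([:: x; y] ++ (s ++ t)) (x :: s ++ y :: t).
  apply: (@TensorCat _ _ _ [:: x] [:: x] (y :: s ++ t)); first exact: TensorRefl.
  rewrite -cat1s -[X in tensor_eq _ (_ ++ X)]cat1s !catA.
  by apply: TensorCat (TensorRefl _); apply: TensorC.
exact: swap.
Qed.

(** Every tensor with values in a free module has a normal form, which depends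
    only on its coordinates; with [tensor_coordP], equality of tensors is equality
    of coordinates. *)
Lemma tensor_eq_coord s : tensor_eq s (of_coord (tensor_coord s) (enum 'I_m)).
Proof.
have tensor0 (a : A) : tensor_eq [:: (a, 0 : 'cV[R]_m)] [::].
  apply: TensorTrans (Tensor0 _ 0); apply: TensorSym.
  by rewrite -[X in (X, _)](scale0r a) -[X in (a, X)](scale0r 0); apply: TensorZ.
elim: s => [|[a v] s IHs].
  elim: (enum _) => [|i l IHl]; first exact: TensorRefl.
  apply: (@TensorCat _ _ _ [::] [:: _] [::] _) IHl.
  by rewrite /tensor_coord big_nil; apply/TensorSym/Tensor0.
have -> : of_coord (tensor_coord ((a, v) :: s)) (enum 'I_m) =
          of_coord (fun i => v i 0 *: a + tensor_coord s i) (enum 'I_m).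
  by apply: eq_map => i; rewrite /tensor_coord big_cons.
apply: TensorTrans (TensorSym (of_coordD _ _ _)).
apply: (@TensorCat _ _ _ [:: _]) IHs.
have {1}-> : v = \sum_(i <- enum 'I_m) v i 0 *: delta_mx i 0.
  by rewrite big_enum {1}[v]matrix_sum_delta; apply: eq_bigr => i _; rewrite big_ord1.
elim: (enum _) => [|i l IHl]; first by rewrite big_nil; apply: tensor0.
rewrite big_cons; apply: TensorTrans (TensorDr _ _ _) _.
by apply: (@TensorCat _ _ _ [:: _] [:: _] [:: _]) IHl; apply/TensorSym/TensorZ.
Qed.
End FreeModule.

Lemma flat_cV m : flat 'cV[R]_m.
Proof.
move=> A B f finj s t /tensor_coordP fst.
have coord_f u i : tensor_coord [seq (f x.1, x.2) | x <- u] i = f (tensor_coord u i).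
  by rewrite /tensor_coord big_map linear_sum; apply: eq_bigr => x _; rewrite linearZ.
have est : tensor_coord s =1 tensor_coord t.
  by move=> i; apply: finj; rewrite -!coord_f.
apply: TensorTrans (tensor_eq_coord s) _.
rewrite /of_coord (eq_map (fun i => congr1 (pair^~ _) (est i))).
exact/TensorSym/tensor_eq_coord.
Qed.

(** The cokernel is a retract of R^m, by the projector 1 - A B. *)
Lemma flat_mx_coker m n (A : 'M[R]_(m, n)) (B : 'M[R]_(n, m)) :
  B *m A = 1%:M -> flat (mx_coker A).
Proof.
move=> BA1; pose sec (q : mx_coker A) : 'cV[R]_m :=
  (1%:M - A *m B) *m repr (q : Quotient.quot (zsub (mx_image A))).
have secE (v : 'cV[R]_m) :
  sec (quotmod_proj (mx_image A) v) = (1%:M - A *m B) *m v.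
  apply/eqP; rewrite -subr_eq0 -mulmxBr.
  have /quotmod_projP/asboolP[x ->] :
    quotmod_proj (mx_image A) (repr (quotmod_proj (mx_image A) v
      : Quotient.quot (zsub (mx_image A)))) = quotmod_proj (mx_image A) v.
    exact: quotmod_projK.
  by rewrite mulmxA mulmxBl -mulmxA BA1 mul1mx mulmx1 subrr mul0mx.
refine (@flat_retract (mx_coker A) 'cV[R]_m sec (quotmod_proj (mx_image A))
  _ _ _ _ _ (@flat_cV m)).
- move=> p q; rewrite -[p]quotmod_projK -[q]quotmod_projK -quotmod_projD.
  by rewrite !secE mulmxDr.
- move=> c q; rewrite -[q]quotmod_projK.
  have -> : c *: quotmod_proj (mx_image A) (repr (q : Quotient.quot (zsub (mx_image A))))
    = quotmod_proj (mx_image A) (c *: repr (q : Quotient.quot (zsub (mx_image A)))).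
    exact: quotmod_projZ.
  by rewrite !secE scalemxAr.
- exact: quotmod_projD.
- by move=> c v; rewrite -quotmod_projZ.
- move=> q; rewrite -[q in LHS]quotmod_projK secE -[RHS]quotmod_projK.
  apply/quotmod_projP/asboolP; exists (- (B *m repr (q : Quotient.quot (zsub (mx_image A))))).
  by rewrite mulmxBl mul1mx addrAC subrr add0r mulmxN mulmxA.
Qed.
End Flatness.

(** * Minimal representations over rings with complemented injections *)

(** The block matrix (A, Q) is invertible, with inverse made of [B] and [P]. *)
Definition complemented_injections (R : comNzRingType) :=
  forall m k (A : 'M[R]_(m, k)), mx_injective A ->
  exists (B : 'M_(k, m)) (P : 'M_(m - k, m)) (Q : 'M_(m, m - k)),
    [/\ B *m A = 1%:M, P *m A = 0, P *m Q = 1%:M & A *m B + Q *m P = 1%:M].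

Section Representations.
Variables (R : comNzRingType) (n k delta : nat).
Hypothesis Rcompl : complemented_injections R.
Variables (G : 'M[{poly R}]_(n, k)) (X : 'M[{poly R}]_(n, delta)).
Hypothesis Ginj : mx_injective G.
Hypothesis Xbasis : state_basis G X.
Local Notation r := (delta + n - k)%N.

(** [z D + R^n] is the direct sum of z D and R^n, so it consists of the
    N (x, c) modulo z C, where N = (z X, 1) and x, c are constant.  A vector
    N (x, c) is in [C] exactly when (x, c) is in the image of the constant matrix
    W, whose j-th column gives the decomposition of the j-th column g_j of [G]:
    the state of the truncation of g_j, and the constant coefficient of g_j.
    This image has rank k, and [E / C] is the cokernel of W.  The rows of [P] are
    coordinates on that cokernel, and [Q] lifts it. *)
Lemma exists_realization : exists (Y : 'M[{poly R}]_(n, r)) K L M,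
  realization G X Y K L M /\ exists P, row_mx L M *m P = 1%:M.
Proof.
have [u0 [U0 eG]] : exists x, congr_mod G (dropmx 1 G) (X *m cst x).
  by have := shift_code Xbasis 1%:M; rewrite mulmx1.
have [u1 [U1 eX]] : exists x, congr_mod G (dropmx 1 X) (X *m cst x).
  apply: (shift_state Xbasis (x := 1%:M)).
  by rewrite map_mx1 mulmx1; apply: congr_refl.
pose W := col_mx u0 (coefmx 0 G).
pose N := row_mx ('X *: X) (1%:M : 'M[{poly R}]_n).
have NW : N *m cst W = G - 'X *: (G *m U0).
  rewrite map_col_mx mul_row_col mul1mx -scalemxAl.
  by rewrite [X in _ = X - _](dropmx_split G) eG [in RHS]scalerDr [in RHS]addrAC addrK.
(* If W b = 0, then G b = z G U0 b, so b = z U0 b, and b is constant. *)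
have Winj : mx_injective W.
  apply: mx_injectiveP => b /(congr1 (fun A => N *m cst A)).
  rewrite map_mxM mulmxA NW map_mx0 mulmx0 mulmxBl -scalemxAl scalemxAr -mulmxA.
  rewrite -mulmxBr => /(mx_injective0 Ginj) /eqP; rewrite subr_eq0 => /eqP e.
  have := @X_cst_inj R _ _ 0 (U0 *m cst b) b 0.
  by rewrite scaler0 add0r map_mx0 addr0 scalemxAr => /(_ e)[].
have [B [P [Q [BW PW PQ WBQP]]]] := Rcompl Winj.
pose Y := N *m cst Q.
have YP : congr_mod G (Y *m cst P) N.
  rewrite /Y -mulmxA -map_mxM.
  have -> : Q *m P = 1%:M - W *m B by rewrite -WBQP addrAC subrr add0r.
  exists (- ((1%:M - 'X *: U0) *m cst B)).
  rewrite map_mxB map_mx1 mulmxBr mulmx1 map_mxM mulmxA NW mulmxN mulmxA.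
  by rewrite mulmxBr mulmx1 scalemxAr.
(* Compare the coefficients of positive degree and the constant ones. *)
have Nfree m (x : 'M[R]_(delta, m)) (c : 'M[R]_(n, m)) (A : 'M_(k, m)) :
    'X *: (X *m cst x) + cst c = G *m A -> col_mx x c = W *m coefmx 0 A.
  rewrite {1}[A]dropmx_split mulmxDr {2}[G]dropmx_split mulmxDl -scalemxAl -map_mxM.
  rewrite -scalemxAr addrA -scalerDr => /X_cst_inj[eXx ->].
  suff -> : x = u0 *m coefmx 0 A by rewrite mul_col_mx.
  apply: (congr_state_eq Xbasis); exists (dropmx 1 A + U0 *m cst (coefmx 0 A)).
  by rewrite eXx eG mulmxDl mulmxDr map_mxM -!mulmxA addrCA.
pose P1 := lsubmx P; pose P2 := rsubmx P.
have P12 : row_mx P1 P2 = P by apply: hsubmxK.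
have NE : row_mx (Y *m cst P1) (Y *m cst P2) = Y *m cst P.
  by rewrite -mul_mx_row -map_row_mx P12.
exists Y, (P *m col_mx u1 (coefmx 0 X)), (- P1), P2; split.
  case: YP => U; rewrite -NE -[U]hsubmxK mul_mx_row add_row_mx.
  move=> /eq_row_mx[eP1 eP2].
  split.
  - move=> m y A YyA; rewrite -[y]mul1mx -PQ -mulmxA.
    rewrite -[Q *m y]vsubmxK (Nfree _ _ _ A) ?mulmxA ?PW ?mul0mx //.
    rewrite -YyA /Y -mulmxA -map_mxM -[X in N *m cst X]vsubmxK map_col_mx.
    by rewrite mul_row_col mul1mx scalemxAl.
  - rewrite map_mxM mulmxA -NE map_col_mx mul_row_col eP1 eP2.
    rewrite [Z in congr_mod _ _ Z](dropmx_split X) eX.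
    exists (lsubmx U *m cst u1 + rsubmx U *m cst (coefmx 0 X) - 'X *: U1).
    rewrite !mulmxDl mul1mx -scalemxAl scalerDr mulmxBr mulmxDr !mulmxA scalemxAr.
    rewrite addrACA [X in _ = X + _]addrAC -[RHS]addrA; congr (_ + _).
    by rewrite [RHS]addrC scalemxAr subrK.
  - rewrite map_mxN mulmxN; apply: congrN; exists (lsubmx U); exact: eP1.
  - exists (rsubmx U); exact: eP2.
exists (col_mx (- usubmx Q) (dsubmx Q)).
by rewrite mul_row_col mulNmx mulmxN opprK -mul_row_col P12 vsubmxK.
Qed.

Lemma exists_minimal_rep :
  exists K L M, minimal_rep (k := k) (delta := delta) (mx_image G) K L M.
Proof.
have [Y [K [L [M [rY LMs]]]]] := exists_realization.
have KMs := rz_surj_KM Xbasis rY LMs.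
exists K, L, M; split=> //.
- exact: (rz_first_order Xbasis rY).
- have Kinj : mx_injective K by apply: mx_injectiveP => x; apply: (rz_K_inj Xbasis rY).
  by have [B [_ [_ [BK _ _ _]]]] := Rcompl Kinj; split=> //; apply: flat_mx_coker BK.
- exact: (rz_surj_pencil Xbasis rY KMs).
Qed.

Lemma complemented_unit m (A : 'M[R]_m) : mx_injective A -> exists B, mx_inverse A B.
Proof.
move=> /Rcompl[B [P [Q [BA _ _ e]]]]; exists B; split=> //.
suff QP0 : Q *m P = 0 by rewrite -e QP0 addr0.
by move: P Q {e}; rewrite subnn => P Q; rewrite (flatmx0 P) mulmx0.
Qed.

Lemma pencil_mulmx (K L : 'M[R]_(r, delta)) m (x : 'M_(delta, m)) :
  pencil K L *m x = cst K *m ('X *: x) + cst L *m x.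
Proof. by rewrite mulmxDl -scalemxAl scalemxAr. Qed.

(** The leading coefficient of [(z K + L) x] is K applied to that of x. *)
Lemma pencil_inj (K L : 'M[R]_(r, delta)) m (x : 'M_(delta, m)) (y : 'M[R]_(r, m)) :
  mx_injective K -> pencil K L *m x = cst y -> y = 0.
Proof.
move=> Kinj exy.
suff x0 : x = 0.
  move: exy; rewrite x0 mulmx0 => exy.
  by have := @X_cst_inj _ _ _ 0 0 0 y; rewrite -exy map_mx0 => /(_ erefl)[_ <-].
have [N] := dropmx_eventually0 x; elim: N => [|N IHN]; first by rewrite drop0mx.
move=> xN; apply: IHN.
have := congr1 (fun A => dropmx N.+1 A) exy.
rewrite dropmx_cst pencil_mulmx dropmxD !dropmx_mulCl dropmxSX xN mulmx0 addr0.
move=> e; apply/matrixP=> i j; apply/polyP=> l.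
pose z := map_mx (coefp l) (dropmx N x).
suff: z = 0 by move=> /matrixP/(_ i j); rewrite !mxE coef0.
apply: mx_injective0 Kinj _; apply/matrixP=> a b.
have /matrixP/(_ a b)/polyP/(_ l) := e; rewrite !mxE coef_sum coef0 => e0.
by rewrite -[RHS]e0; apply: eq_bigr => c _; rewrite !mxE /= coefCM.
Qed.

Section FromMinimal.
Variables (K L : 'M[R]_(r, delta)) (M : 'M[R]_(r, n)).
Hypothesis KLM : minimal_rep (k := k) (mx_image G) K L M.

(** [Y] is the lower part of a right inverse of [(z K + L, M)]; it induces the
    isomorphism from the cokernel of z K + L to R[z]^n / C that is inverse to M.
    Truncating the equation [(z K + L) x + M v = 0] at N expresses the truncation
    of v by the coefficient of index N - 1 of x if N > 0, whence [S]; for N = 0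
    the vector v is zero modulo C. *)
Lemma minimal_rep_observer : exists Y : 'M[{poly R}]_(n, r),
  [/\ const_free G Y,
      congr_mod G (Y *m pencil K L) 0,
      congr_mod G (Y *m cst M) 1%:M
    & exists2 S, mx_injective S & congr_mod G X (Y *m cst (K *m S))].
Proof.
case: KLM => KLrep [Kinj _] _ /mx_surjectiveP[P].
rewrite -[P]vsubmxK mul_row_col; set A := usubmx P; set Y := dsubmx P => AY1.
have in_code m (V : 'M[{poly R}]_(n, m)) (Z : 'M_(delta, m)) :
    pencil K L *m Z + cst M *m V = 0 -> congr_mod G V 0.
  move=> e; have colV j : exists a : 'cV_k, col j V = G *m a.
    apply/asboolP/KLrep; exists (col j Z).
    by rewrite !colE !mulmxA -mulmxDl e mul0mx.
  have [U eU] := mx_choice colV; exists U; rewrite add0r.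
  by apply: col_eq_mx => j; rewrite eU !colE mulmxA.
have [Z eZ] : exists Z, pencil K L *m Z + cst M *m G = 0.
  have colG j : exists z : 'cV_delta, pencil K L *m z + cst M *m col j G = 0.
    by apply/KLrep/asboolP; exists (delta_mx j 0); rewrite -colE.
  have [Z eZ] := mx_choice colG; exists Z; apply: col_eq_mx => j.
  by rewrite -[RHS](_ : 0 = _) ?colE ?mul0mx // mulmxDl -!mulmxA -!colE eZ.
have free : const_free G Y.
  move=> m y B e; apply: (@pencil_inj K L _ (A *m cst y - Z *m B)) => //.
  have eMG : cst M *m (G *m B) = - (pencil K L *m (Z *m B)).
    by apply/eqP; rewrite -addr_eq0 !mulmxA -mulmxDl addrC eZ mul0mx.
  by rewrite mulmxBr -eMG -e !mulmxA -mulmxDl AY1 mul1mx.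
have Ypencil : congr_mod G (Y *m pencil K L) 0.
  apply: (in_code _ _ (A *m pencil K L - 1%:M)).
  by rewrite mulmxBr mulmx1 !mulmxA addrAC -mulmxDl AY1 mul1mx subrr.
have YM : congr_mod G (Y *m cst M) 1%:M.
  rewrite -[Y *m _](subrK 1%:M) -[X in congr_mod _ _ X]add0r.
  apply: congrD (congr_refl _ _); apply: (in_code _ _ (A *m cst M)).
  by rewrite mulmxBr mulmx1 !mulmxA addrA -mulmxDl AY1 mul1mx subrr.
exists Y; split=> //.
have [N [V eX]] := state_drop Xbasis.
have [c ec] := dropmx_X N (Z *m V).
pose W := dropmx N (Z *m V).
have eW : pencil K L *m W + cst (K *m c) + cst M *m X = 0.
  have := congr1 (fun A => dropmx N (A *m V)) eZ.
  rewrite mul0mx dropmx0 mulmxDl -!mulmxA dropmxD dropmx_mulCl -eX => <-.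
  rewrite !pencil_mulmx dropmxD !dropmx_mulCl ec.
  by rewrite mulmxDr map_mxM; congr (_ + _); rewrite addrAC.
have XYKc : congr_mod G X (Y *m cst (K *m - c)).
  rewrite -[X]mul1mx; apply: congr_trans (congr_sym (congrMr _ YM)) _.
  have -> : Y *m cst M *m X = - (Y *m pencil K L *m W) + Y *m cst (K *m - c).
    have eMX : cst M *m X = - (pencil K L *m W + cst (K *m c)).
      by apply/eqP; rewrite -addr_eq0 addrC eW.
    by rewrite -mulmxA eMX !mulmxN map_mxN mulmxN mulmxDr opprD mulmxA.
  rewrite -[X in congr_mod _ _ X]add0r; apply: congrD (congr_refl _ _).
  rewrite -oppr0; apply: congrN; rewrite -[X in congr_mod _ _ X](mul0mx _ W).
  exact: congrMr Ypencil.
exists (- c) => //; apply: mx_injectiveP => x cx0.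
apply: (congr_state_eq Xbasis); apply: congr_trans (congrMr _ XYKc) _.
by rewrite -mulmxA -map_mxM -mulmxA cx0 !mulmx0 !map_mx0 !mulmx0; apply: congr_refl.
Qed.
End FromMinimal.

Section Comparison.
Variables (K L K' L' : 'M[R]_(r, delta)) (M M' : 'M[R]_(r, n)).
Hypotheses (KLM : minimal_rep (k := k) (mx_image G) K L M)
  (KLM' : minimal_rep (k := k) (mx_image G) K' L' M').

(** The matrices [S] and [S'] compare both state spaces with the one of the
    code; the columns of [Y] span those of [K] and the constant vectors, hence
    the same module [E / C] for both representations. *)
Lemma minimal_rep_unique : equivalent_rep K L M K' L' M'.
Proof.
have [Y [Yfree YL YM [S Sinj XY]]] := minimal_rep_observer KLM.
have [Y' [Yfree' YL' YM' [S' Sinj' XY']]] := minimal_rep_observer KLM'.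
have [Si [SSi SiS]] := complemented_unit Sinj.
have [Si' [SSi' SiS']] := complemented_unit Sinj'.
have transfer (Y1 Y2 : 'M[{poly R}]_(n, r)) K1 K2 (S1 S1i S2 : 'M[R]_delta) :
    S1 *m S1i = 1%:M -> congr_mod G X (Y1 *m cst (K1 *m S1)) ->
    congr_mod G X (Y2 *m cst (K2 *m S2)) ->
    congr_mod G (Y1 *m cst K1) (Y2 *m cst (K2 *m (S2 *m S1i))).
  move=> SSi1 X1 X2; have -> : K1 = K1 *m S1 *m S1i by rewrite -mulmxA SSi1 mulmx1.
  rewrite map_mxM !mulmxA map_mxM mulmxA [in Z in congr_mod _ _ Z]map_mxM mulmxA.
  apply: congrMr; rewrite -mulmxA -map_mxM.
  exact: congr_trans (congr_sym X1) X2.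
have YK := transfer _ _ _ _ _ _ _ SSi XY XY'.
have YK' := transfer _ _ _ _ _ _ _ SSi' XY' XY.
have span K1 M1 K2 M2 Y1 Y2 (V : 'M[R]_delta) :
    mx_surjective (row_mx K1 M1) ->
    congr_mod G (Y1 *m cst K1) (Y2 *m cst (K2 *m V)) ->
    congr_mod G (Y1 *m cst M1) 1%:M -> congr_mod G (Y2 *m cst M2) 1%:M ->
    exists T : 'M[R]_r, congr_mod G Y1 (Y2 *m cst T).
  move=> /mx_surjectiveP[P]; rewrite -[P]vsubmxK mul_row_col => KMP eK eM1 eM2.
  exists (K2 *m V *m usubmx P + M2 *m dsubmx P).
  rewrite -[Y1]mulmx1 -(map_mx1 polyC) -KMP !map_mxD !mulmxDr.
  rewrite map_mxM [cst (M1 *m _)]map_mxM [cst (M2 *m _)]map_mxM.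
  rewrite [cst (K2 *m V *m _)]map_mxM !mulmxA.
  apply: congrD; apply: congrMr => //; exact: congr_trans eM1 (congr_sym eM2).
case: KLM => _ _ KMs _; case: KLM' => _ _ KMs' _.
have [T YT] := span _ _ _ _ _ _ _ KMs YK YM YM'.
have [T' YT'] := span _ _ _ _ _ _ _ KMs' YK' YM' YM.
have TT' : T *m T' = 1%:M.
  apply: (const_free_eq Yfree'); rewrite map_mx1 mulmx1 map_mxM mulmxA.
  exact: congr_trans (congrMr _ (congr_sym YT)) (congr_sym YT').
have TT1 : T' *m T = 1%:M.
  apply: (const_free_eq Yfree); rewrite map_mx1 mulmx1 map_mxM mulmxA.
  exact: congr_trans (congrMr _ (congr_sym YT')) (congr_sym YT).
pose V := S' *m Si; pose Vi := S *m Si'.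
have VVi : V *m Vi = 1%:M by rewrite /V /Vi mulmxA -(mulmxA S') SiS mulmx1.
have ViV : Vi *m V = 1%:M by rewrite /V /Vi mulmxA -(mulmxA S) SiS' mulmx1.
have YTmx m (x : 'M[R]_(r, m)) : congr_mod G (Y' *m cst (T *m x)) (Y *m cst x).
  by rewrite map_mxM mulmxA; apply/congrMr/congr_sym.
have TK : T *m K = K' *m V.
  by apply: (const_free_eq Yfree'); apply: congr_trans (YTmx _ _) YK.
have TM : T *m M = M'.
  apply: (const_free_eq Yfree'); apply: congr_trans (YTmx _ _) _.
  exact: congr_trans YM (congr_sym YM').
have pencilL (Z : 'M[{poly R}]_(n, r)) (K0 L0 : 'M[R]_(r, delta)) :
     congr_mod G (Z *m pencil K0 L0) 0 ->
    congr_mod G (Z *m cst L0) (- ('X *: (Z *m cst K0))).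
  move=> e; rewrite -[X in congr_mod _ _ X]addr0.
  apply: congr_trans (congrD (congr_refl _ _) e).
  by rewrite mulmxDr -scalemxAr addKr; apply: congr_refl.
have TL : T *m L = L' *m V.
  apply: (const_free_eq Yfree'); apply: congr_trans (YTmx _ _) _.
  apply: congr_trans (pencilL _ _ _ YL) _.
  rewrite map_mxM mulmxA; apply: congr_sym.
  apply: congr_trans (congrMr _ (pencilL _ _ _ YL')) _.
  rewrite mulNmx; apply: congrN; rewrite -scalemxAl; apply: congrZ.
  by rewrite -mulmxA -map_mxM; apply: congr_sym.
exists T, T', V, Vi; split=> //.
- by rewrite TK -mulmxA VVi mulmx1.
- by rewrite TL -mulmxA VVi mulmx1.
Qed.
End Comparison.
End Representations.

(** * Column reduced generators *)

Section ColumnReduced.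
Variables (R : comNzRingType) (n k : nat).
Implicit Types (nu : 'I_k -> nat) (G : 'M[{poly R}]_(n, k)).

(** The matrix of the coefficients of degree nu_j in column j is injective, so
    that nu_j is the degree of that column, and leading terms cannot cancel. *)
Definition column_reduced nu G :=
  (forall i j, (size (G i j) <= (nu j).+1)%N) /\
  mx_injective (\matrix_(i, j) (G i j)`_(nu j)).

(** Forney's predictable degree property.  If D is the largest value of the
    degree of B_j plus nu_j, the coefficients of degree D in G B are the leading
    matrix of [G] applied to the coefficients of degree D - nu_j of the B_j. *)
Lemma predictable_degree nu G m (B : 'M_(k, m)) N :
    column_reduced nu G -> (forall i l, (size ((G *m B) i l) <= N)%N) ->
  forall j l d, (N <= d + nu j)%N -> (B j l)`_d = 0.
Proof.
move=> [sG Hinj] sGB j l d; pose P D := forall j d, (D <= d + nu j)%N -> (B j l)`_d = 0.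
suff PN : P N by apply: PN.
have step D : (N <= D)%N -> P D.+1 -> P D.
  move=> leND PD j0 d0; rewrite leq_eqVlt => /orP[/eqP eD|]; last exact: PD.
  (* A column with nu_j > D has nothing in degree D - nu_j. *)
  pose b : 'cV[R]_k := \col_j if (nu j <= D)%N then (B j l)`_(D - nu j) else 0.
  suff : b = 0 by move/matrixP/(_ j0 0); rewrite !mxE eD leq_addl addnK.
  apply: mx_injective0 Hinj _; apply/matrixP=> i o; rewrite !mxE.
  have := leq_sizeP _ _ (sGB i l) D leND; rewrite mxE coef_sum => e0.
  rewrite -[RHS]e0; apply: eq_bigr => c _; rewrite !mxE coefM; case: ifP => nuD.
    rewrite (bigD1 (inord (nu c))) //= inordK ?ltnS // big1 ?addr0 // => a.
    rewrite -val_eqE /= inordK ?ltnS // neq_ltn => /orP[lta|gta].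
      rewrite (PD c) ?mulr0 //.
      by rewrite -[D in (D < _)%N](subnK (ltn_ord a : (a <= D)%N)) -addnS leq_add2l.
    by rewrite [_`_a](leq_sizeP _ _ (sG i c)) ?mul0r.
  rewrite mulr0 big1 // => a _; rewrite (PD c) ?mulr0 //.
  rewrite -[D in (D < _)%N](subnK (ltn_ord a : (a <= D)%N)) -addnS leq_add2l.
  by rewrite (leq_ltn_trans (ltn_ord a : (a <= D)%N)) // ltnNge nuD.
have [t Pt] : exists t, P (N + t)%N.
  exists (\max_j nu j + \max_j size (B j l))%N => c a le_a.
  apply: (leq_sizeP _ (\max_j size (B j l))).
    exact: (leq_bigmax (F := fun j => size (B j l)) c).
  rewrite -(leq_add2l (nu c)) [X in (_ <= X)%N]addnC; apply: leq_trans le_a.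
  by rewrite -[X in (X <= _)%N]add0n leq_add // leq_add2r; apply: leq_bigmax.
elim: t Pt => [|t IHt]; first by rewrite addn0.
by rewrite addnS => /step; move/(_ (leq_addr _ _))/IHt.
Qed.

(** The pair of a column j and of i < nu_j indexes the polynomial part of
    z^-(i+1) g_j.  The matrix [E] gives multiples of the g_j whose truncations at
    the common index [N] are these vectors. *)
Section StateBasisOfReduced.
Variables (nu : 'I_k -> nat) (G : 'M[{poly R}]_(n, k)).
Hypothesis Gred : column_reduced nu G.

Let T := {j : 'I_k & 'I_(nu j)}.
Let N := (\sum_j nu j)%N.
Let tg (c : 'I_#|{: T}|) : 'I_k := tag (enum_val c).
Let ix (c : 'I_#|{: T}|) : nat := tagged (enum_val c : T).

Let X : 'M[{poly R}]_(n, #|{: T}|) :=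
  \matrix_(i, c) drop_poly (ix c).+1 (G i (tg c)).
Let E : 'M[{poly R}]_(k, #|{: T}|) :=
  \matrix_(j, c) if j == tg c then 'X^(N - (ix c).+1) else 0.

Let lt_ix c : (ix c < nu (tg c))%N. Proof. exact: ltn_ord. Qed.

Let nu_le_N j : (nu j <= N)%N.
Proof. by rewrite /N (bigD1 j) //= leq_addr. Qed.

Let ix_le_N c : ((ix c).+1 <= N)%N.
Proof. exact: leq_trans (lt_ix c) (nu_le_N _). Qed.

Let tg_ix_inj c c' : tg c = tg c' -> ix c = ix c' -> c = c'.
Proof.
move=> et ei; apply: enum_val_inj; move: et ei; rewrite /tg /ix.
case: (enum_val c) => j i; case: (enum_val c') => j' i' /= ej.
by subst j' => /val_inj->.
Qed.

Let tg_ix_surj j d : (d < nu j)%N -> exists2 c, tg c = j & ix c = d.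
Proof.
move=> ltd; pose t : T := Tagged (fun j => 'I_(nu j)) (Ordinal ltd).
by exists (enum_rank t); rewrite /tg /ix enum_rankK.
Qed.

Let GE i c : (G *m E) i c = G i (tg c) * 'X^(N - (ix c).+1).
Proof.
rewrite mxE (bigD1 (tg c)) //= mxE eqxx big1 ?addr0 // => j /negPf nj.
by rewrite mxE nj mulr0.
Qed.

Let X_drop : X = dropmx N (G *m E).
Proof.
apply/matrixP=> i c; rewrite [LHS]mxE [RHS]mxE GE; apply/polyP=> d.
rewrite !coef_drop_poly coefMXn ltnNge.
have le := leq_subr (ix c).+1 N; rewrite (leq_trans le (leq_addl _ _)) /=.
by congr (_`_ _); rewrite -addnBA // subKn.
Qed.

(** If X x = G A, then z^N X x - G E x has degree less than N, as each of its
   terms is a product z^(N-i) low, where low has degree less than i.  So has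
   G (z^N A - E x), and the predictable degree property kills the coefficients of
   degree N - i of z^N A - E x, for 0 < i <= nu_j, which are those of - x. *)
Let X_free m (x : 'M[R]_(#|{: T}|, m)) A : X *m cst x = G *m A -> x = 0.
Proof.
move=> eXA; pose B := 'X^N *: A - E *m cst x.
have sGB i l : (size ((G *m B) i l) <= N)%N.
  have -> : G *m B = ('X^N *: X - G *m E) *m cst x.
    by rewrite /B mulmxBr -scalemxAr -eXA mulmxBl scalemxAl mulmxA.
  rewrite mxE; apply: leq_trans (size_sum _ _ _) _; apply/bigmax_leqP=> c _.
  rewrite [cst x c l]mxE mulrC mul_polyC; apply: leq_trans (size_scale_leq _ _) _.
  rewrite mxE [Z in _ + Z]mxE GE [Z in Z - _]mxE [X i c]mxE.
  set g := G i _; rewrite -[g in X in _ - X](poly_take_drop (ix c).+1).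
  rewrite mulrDl -mulrA -exprD subnKC // ['X^N * _]mulrC opprD addrCA subrr addr0.
  rewrite size_opp; apply: leq_trans (size_polyMleq _ _) _.
  rewrite size_polyXn addnS /= -[X in (_ <= X)%N](subnKC (ix_le_N c)) leq_add2r.
  exact: size_take_poly.
apply/matrixP=> c l; rewrite mxE.
have leN : (N <= N - (ix c).+1 + nu (tg c))%N.
  by rewrite -{1}(subnK (ix_le_N c)) leq_add2l.
have := predictable_degree Gred sGB l leN.
rewrite !mxE coefB coefXnM coef_sum ltn_subrL /= (leq_trans _ (ix_le_N c)) //.
rewrite sub0r (bigD1 c) //= big1 => [|c' /eqP nc].
  rewrite !mxE eqxx coefMC coefXn eqxx mul1r addr0 => /eqP.
  by rewrite oppr_eq0 => /eqP.
rewrite !mxE coefMC; case: eqP => [et|_]; last by rewrite coef0 mul0r.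
rewrite coefXn; case: eqP => [ei|_]; last by rewrite mul0r.
case: nc; apply: tg_ix_inj => //; apply: succn_inj.
by rewrite -[LHS](subKn (ix_le_N c')) -ei subKn.
Qed.

Let drop_G d : exists u : 'M[R]_(#|{: T}|, k), dropmx d.+1 G = X *m cst u.
Proof.
exists (\matrix_(c, j) ((tg c == j) && (ix c == d))%:R).
apply/matrixP=> i j; rewrite [LHS]mxE [RHS]mxE.
have [ltd|led] := ltnP d (nu j).
  have [c <- <-] := tg_ix_surj ltd.
  rewrite (bigD1 c) //= !mxE !eqxx mulr1 big1 ?addr0 // => c' nc; rewrite !mxE.
  case: andP => [[/eqP et /eqP ei]|_]; last by rewrite mulr0.
  by case/eqP: nc; apply: tg_ix_inj.
rewrite drop_poly_eq0; last exact: leq_trans (Gred.1 i j) _.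
rewrite big1 // => c _; rewrite !mxE; case: andP => [[/eqP et /eqP ei]|_].
  by have := lt_ix c; rewrite et ei ltnNge led.
by rewrite mulr0.
Qed.

Lemma state_basis_of_reduced :
  exists X : 'M[{poly R}]_(n, \sum_j nu j), state_basis G X.
Proof.
have <- : #|{: T}| = (\sum_j nu j)%N.
  rewrite card_tagged sumnE big_map big_enum /=.
  by apply: eq_bigr => j _; rewrite card_ord.
exists X; split; first exact: X_free.
  move=> m d; elim: d => [|d IHd] A.
    by exists 0; rewrite drop0mx map_mx0 mulmx0; apply: congr_im.
  have [x ex] := IHd (dropmx 1 A); have [u eu] := drop_G d.
  exists (x + u *m coefmx 0 A); rewrite [A in G *m A]dropmx_split mulmxDr dropmxD.
  rewrite -scalemxAr dropmxSX map_mxD mulmxDr; apply: congrD ex _.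
  by rewrite dropmx_mulC eu map_mxM mulmxA; apply: congr_refl.
by exists N, E; apply: X_drop.
Qed.
End StateBasisOfReduced.

Lemma state_basis_change delta G (U U' : 'M_k) (X : 'M_(n, delta)) :
  U *m U' = 1%:M -> state_basis (G *m U) X -> state_basis G X.
Proof.
move=> UU' [Xfree Xgen [N [V eX]]]; split.
- move=> m x A eXA; apply: (Xfree _ x (U' *m A)).
  by rewrite -mulmxA (mulmxA U) UU' mul1mx.
- move=> m N' A; have [x [V' eV']] := Xgen m N' (U' *m A).
  exists x, (U *m V').
  by rewrite mulmxA -eV' -mulmxA (mulmxA U) UU' mul1mx.
- by exists N, (U *m V); rewrite mulmxA.
Qed.
End ColumnReduced.

(** * Fields: complements, reduction and minors *)

Section OverField.
Variable F : fieldType.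

Lemma mx_injective_row_full m k (A : 'M[F]_(m, k)) : mx_injective A -> row_full A.
Proof.
move=> Ainj; suff: row_free A^T by rewrite /row_free /row_full mxrank_tr.
rewrite -kermx_eq0; apply/eqP/trmx_inj; rewrite trmx0.
apply: mx_injective0 Ainj _; apply: trmx_inj.
by rewrite trmx_mul trmxK mulmx_ker trmx0.
Qed.

Lemma field_complemented_injections : complemented_injections F.
Proof.
move=> m k A /mx_injective_row_full Afull.
have BA1 := mulVpmx Afull; set B := pinvmx A in BA1.
have [P0 [P0free P0A eP0]] : exists P : 'M_(m - k, m),
    [/\ row_free P, P *m A = 0 & (P :=: kermx A)%MS].
  have eker : \rank (kermx A) = (m - k)%N by rewrite mxrank_ker (eqP Afull).
  move: (eq_row_base (kermx A)) (row_base_free (kermx A)).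
  move: (row_base (kermx A)); rewrite eker => P eP Pfree; exists P; split=> //.
  by apply/sub_kermxP; rewrite eP.
pose Q := (1%:M - A *m B) *m pinvmx P0.
have PQ : P0 *m Q = 1%:M.
  by rewrite /Q mulmxA mulmxBr mulmx1 (mulmxA P0 A) P0A mul0mx subr0 mulmxVp.
exists B, P0, Q; split=> //.
have /submxP[Z eZ] : (1%:M - A *m B <= P0)%MS.
  by rewrite eP0; apply/sub_kermxP; rewrite mulmxBl mul1mx -mulmxA BA1 mulmx1 subrr.
by rewrite /Q eZ -(mulmxA Z) mulmxVp // mulmx1 -eZ addrC subrK.
Qed.

(** If a constant vector l is killed by the leading matrix, choose j with nu_j
    maximal among those with l_j nonzero.  The combination of the columns with
    coefficients l_i z^(nu_j - nu_i) has degree less than nu_j and can replace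
    column j, which lowers the sum of the degrees. *)
Lemma exists_column_reduced n k (G : 'M[{poly F}]_(n, k)) : mx_injective G ->
  exists nu (U U' : 'M_k), U *m U' = 1%:M /\ column_reduced nu (G *m U).
Proof.
have [nu sG] : exists nu : 'I_k -> nat, forall i j, (size (G i j) <= (nu j).+1)%N.
  exists (fun j => \max_i size (G i j)) => i j; apply: leqW.
  exact: (leq_bigmax (F := fun i => size (G i j))).
have [s] := ubnP (\sum_j nu j)%N; elim: s => // s IHs in nu G sG *.
rewrite ltnS => le_nu Ginj; set H := \matrix_(i, j) (G i j)`_(nu j).
have [Hinj|Hninj] := pselect (mx_injective H).
  by exists nu, 1%:M, 1%:M; rewrite !mulmx1.
have [l [Hl0 l_neq0]] : exists l : 'cV[F]_k, H *m l = 0 /\ l != 0.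
  apply: contrapT => no; apply/Hninj/mx_injectiveP => l Hl; apply/eqP.
  by apply/negP=> /negP l0; apply: no; exists l.
have [j0 lj0] : exists j, l j 0 != 0.
  apply/existsP; apply: contraR l_neq0 => /existsPn l0.
  by apply/eqP/matrixP=> j o; rewrite ord1 mxE; apply/eqP/negbNE/l0.
case: (@arg_maxnP _ j0 (fun j => l j 0 != 0) nu lj0) => j lj jmax {j0 lj0}.
pose u : 'cV[{poly F}]_k := \col_i ((l i 0)%:P * 'X^(nu j - nu i)).
pose e : 'rV[{poly F}]_k := delta_mx 0 j; pose w := u - e^T.
have uj : u j 0 = (l j 0)%:P by rewrite mxE subnn mulr1.
have ew : e *m w = (l j 0 - 1)%:P%:M.
  apply/matrixP=> a b; rewrite !ord1 -rowE /w mxE mxE uj !mxE !eqxx mulr1n.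
  by rewrite polyCB.
have eu0 i d : (nu j <= d)%N -> ((G *m u) i 0)`_d = 0.
  move=> led; rewrite mxE coef_sum.
  have term c : (G i c * u c 0)`_d = if d == nu j then H i c * l c 0 else 0.
    rewrite !mxE mulrCA coefCM coefMXn.
    have [->|lc] := eqVneq (l c 0) 0; first by rewrite mul0r mulr0 if_same.
    have le_c : (nu c <= nu j)%N by apply: jmax.
    rewrite ltnNge (leq_trans (leq_subr _ _) led) /=.
    have -> : (d - (nu j - nu c) = d - nu j + nu c)%N.
      by rewrite subnA // addnBAC.
    have [->|nd] := eqVneq d (nu j); first by rewrite subnn mulrC.
    rewrite [_`_(_ + _)](leq_sizeP _ _ (sG i c)) ?mulr0 //.
    by rewrite -[X in (X < _)%N]add0n ltn_add2r subn_gt0 ltn_neqAle eq_sym nd.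
  under eq_bigr do rewrite term.
  case: eqP => _; last by rewrite big1.
  by have /matrixP/(_ i 0) := Hl0; rewrite !mxE.
have nuj_gt0 : (0 < nu j)%N.
  rewrite lt0n; apply/eqP=> nuj0; case/eqP: lj.
  have /matrixP/(_ j 0) : u = 0.
    apply: mx_injective0 Ginj _; apply/matrixP=> i o; rewrite ord1.
    by apply/polyP=> d; rewrite eu0 ?nuj0 // mxE coef0.
  by rewrite uj mxE => /polyC_inj.
(* As e w = l_j - 1, the inverse of 1 + w e is 1 - w e / l_j. *)
pose U := 1%:M + w *m e; pose U' := 1%:M - (l j 0)^-1%:P *: (w *m e).
have UU' : U *m U' = 1%:M.
  have wewe : w *m e *m (w *m e) = (l j 0 - 1)%:P *: (w *m e).
    by rewrite -mulmxA (mulmxA e) ew mul_scalar_mx scalemxAr.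
  rewrite mulmxBr mulmx1 mulmxDl mul1mx -scalemxAr wewe scalerA -polyCM.
  rewrite mulrBr mulr1 mulVf // polyCB scalerBl polyC1 scale1r.
  by rewrite [_ *: _ + _]addrC subrK addrK.
have GU : G *m U = G + (G *m w) *m e by rewrite mulmxDr mulmx1 mulmxA.
pose nu' i := if i == j then (nu j).-1 else nu i.
have [||| mu [V [V' [VV' red]]]] := IHs nu' (G *m U).
- move=> i c; rewrite GU mxE -[e in _ *m e]/(delta_mx _ _) /nu'.
  have -> : (G *m w *m e) i c = (G *m w) i 0 *+ (c == j).
    by rewrite mxE big_ord1 [e 0 c]mxE eqxx mulr_natr.
  case: eqP => [->|_]; last by rewrite addr0.
  have -> : G i j + (G *m w) i 0 *+ true = (G *m u) i 0.
    have -> : (G *m w) i 0 = (G *m u) i 0 - G i j.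
      by rewrite /w mulmxBr mxE [Z in _ + Z]mxE /e trmx_delta -colE [col j G i 0]mxE.
    by rewrite addrC subrK.
  by rewrite prednK //; apply/leq_sizeP => d; apply: eu0.
- apply: leq_trans le_nu; rewrite (bigD1 j) //= [X in (_ < X)%N](bigD1 j) //=.
  rewrite /nu' eqxx -addSn prednK //; apply: eq_leq; congr addn.
  by apply: eq_bigr => i /negPf->.
- apply: mx_injectiveP => x; rewrite -mulmxA => /(mx_injective0 Ginj) Ux0.
  by rewrite -[x]mul1mx -(mulmx1C UU') -mulmxA Ux0 mulmx0.
exists mu, (U *m V), (V' *m U'); split; last by rewrite mulmxA.
by rewrite -mulmxA (mulmxA V) VV' mul1mx.
Qed.

Lemma coef_mul_top (p q : {poly F}) d e :
    (size p <= d.+1)%N -> (size q <= e.+1)%N ->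
  (size (p * q)%R <= (d + e).+1)%N /\ (p * q)`_(d + e) = p`_d * q`_e.
Proof.
move=> sp sq; split.
  apply: leq_trans (size_polyMleq p q) _.
  by have := leq_add sp sq; rewrite addSn addnS; case: (_ + _)%N.
rewrite coefM (bigD1 (inord d)) //= inordK ?ltnS ?leq_addr // addKn.
rewrite big1 ?addr0 // => a; rewrite -val_eqE /= inordK ?ltnS ?leq_addr //.
rewrite neq_ltn => /orP[lta|gta]; last by rewrite (leq_sizeP _ _ sp) ?mul0r.
by rewrite (leq_sizeP _ _ sq) ?mulr0 // ltn_subRL ltn_add2r.
Qed.

Lemma det_top k (nu : 'I_k -> nat) (A : 'M[{poly F}]_k) :
    (forall i j, (size (A i j) <= (nu j).+1)%N) ->
  (size (\det A) <= (\sum_j nu j).+1)%N /\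
  (\det A)`_(\sum_j nu j) = \det (\matrix_(i, j) (A i j)`_(nu j)).
Proof.
move=> sA.
have prod_top (s : 'S_k) :
    (size (\prod_i A i (s i))%R <= (\sum_j nu j).+1)%N /\
    (\prod_i A i (s i))`_(\sum_j nu j) = \prod_i (A i (s i))`_(nu (s i)).
  have -> : (\sum_j nu j = \sum_i nu (s i))%N by apply: reindex_inj perm_inj.
  elim/big_rec3: _ => [|i c d p _ [sp <-]]; first by rewrite size_poly1 coef1.
  exact: coef_mul_top (sA i (s i)) sp.
split.
  apply: leq_trans (size_sum _ _ _) _; apply/bigmax_leqP=> s _.
  by rewrite mulr_sign; case: ifP => _; rewrite ?size_polyN; have [] := prod_top s.
rewrite coef_sum; apply: eq_bigr => s _; rewrite !mulr_sign.
have [_ e] := prod_top s.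
have -> : \prod_i (\matrix_(i, j) (A i j)`_(nu j)) i (s i)
    = \prod_i (A i (s i))`_(nu (s i)).
  by apply: eq_bigr => i _; rewrite mxE.
by case: ifP => _; rewrite ?coefN e.
Qed.

(** Sorting the rows of an invertible square submatrix keeps their span. *)
Lemma exists_increasing_minor n k (H : 'M[F]_(n, k)) : mx_injective H ->
  exists2 f : {ffun 'I_k -> 'I_n},
    [forall i : 'I_k, forall j : 'I_k, (i < j)%N ==> (f i < f j)%N]
    & \det (rowsub f H) != 0.
Proof.
move=> /mx_injective_row_full Hfull; pose f0 := fullrankfun Hfull.
pose S := f0 @: 'I_k.
have cardS : #|S| = k by rewrite card_imset ?card_ord //; apply: fullrankfun_inj.
have sortS : sorted ltn (map val (enum S)).
  rewrite -[enum _](eq_filter (mem_enum _)).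
  rewrite -(eq_filter (mem_map val_inj _)) -filter_map.
  by rewrite (sorted_filter ltn_trans) // unlock val_ord_enum iota_ltn_sorted.
pose f : {ffun 'I_k -> 'I_n} := [ffun i => enum_val (cast_ord (esym cardS) i)].
exists f.
  apply/forallP=> i; apply/forallP=> j; apply/implyP=> lt_ij; rewrite !ffunE.
  have x0 : 'I_n := enum_val (cast_ord (esym cardS) i).
  rewrite !(enum_val_nth x0) /=.
  have := @sorted_ltn_nth _ _ ltn_trans (val x0) _ sortS i j.
  rewrite !inE !size_map -cardE cardS !ltn_ord !(nth_map x0) -?cardE ?cardS //.
  by apply.
have -> : (\det (rowsub f H) != 0) = (rowsub f H \in unitmx).
  by rewrite unitmxE unitfE.
rewrite -row_full_unit -sub1mx; apply: submx_trans (_ : (rowsub f0 H <= _)%MS).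
  by rewrite sub1mx fullrowsub_full.
apply/row_subP=> i; have f0iS : f0 i \in S by apply: imset_f.
pose l := cast_ord cardS (enum_rank_in f0iS (f0 i)).
have fl : f l = f0 i by rewrite ffunE cast_ordK enum_rankK_in.
have -> : row i (rowsub f0 H) = row l (rowsub f H) by rewrite !row_rowsub fl.
exact: row_sub.
Qed.

Lemma max_minor_degree_reduced n k nu (G : 'M[{poly F}]_(n, k)) :
  column_reduced nu G -> max_minor_degree G = (\sum_j nu j)%N.
Proof.
move=> [sG Hinj].
have top (f : {ffun 'I_k -> 'I_n}) :=
  @det_top _ nu (rowsub f G) (fun i j => ltac:(rewrite mxE; exact: sG)).
apply/eqP; rewrite eqn_leq; apply/andP; split.
  apply/bigmax_leqP=> f _; have [le _] := top f.
  by case: (size _) le.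
have [f finc detf] := exists_increasing_minor Hinj.
apply: leq_trans (leq_bigmax_cond f finc).
have [_ e] := top f; have: (\det (rowsub f G))`_(\sum_j nu j) != 0.
  rewrite e; congr (\det _ != 0): detf.
  by apply/matrixP=> i j; rewrite !mxE.
case: leqP => // lt; rewrite (leq_sizeP _ _ (leqnn _)) ?eqxx //.
by move: lt; case: (size _).
Qed.

(** Generators of the same module are multiples of each other, say by U and U'.
    As soon as one minor is nonzero, det U det U' = 1, so these are constants; if
    all minors are zero, there is nothing to compare. *)
Lemma max_minor_degree_eq n k (G G' : 'M[{poly F}]_(n, k)) :
  mx_image G =i mx_image G' -> max_minor_degree G = max_minor_degree G'.
Proof.
have factor (A B : 'M[{poly F}]_(n, k)) :
    {subset mx_image A <= mx_image B} -> exists U, A = B *m U.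
  move=> sub; have colA j : exists u : 'cV_k, col j A = B *m u.
    by apply/asboolP/sub/asboolP; exists (delta_mx j 0); rewrite -colE.
  have [U eU] := mx_choice colA; exists U; apply: col_eq_mx => j.
  by rewrite eU !colE mulmxA.
move=> eGG'; have [U eG] : exists U, G = G' *m U by apply: factor => v; rewrite eGG'.
have [U' eG'] : exists U', G' = G *m U' by apply: factor => v; rewrite eGG'.
apply: eq_bigr => f _.
have detf : \det (rowsub f G) = \det (rowsub f G') * \det U.
  by rewrite eG -det_mulmx -mul_rowsub_mx.
have detf' : \det (rowsub f G') = \det (rowsub f G) * \det U'.
  by rewrite eG' -det_mulmx -mul_rowsub_mx.
have [d0|d0] := eqVneq (\det (rowsub f G)) 0.
  by rewrite detf' d0 mul0r.
have dUU : \det U' * \det U = 1.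
  by apply: (mulfI d0); rewrite mulrA -detf' -detf mulr1.
have : size (\det U' * \det U) == 1%N by rewrite dUU size_poly1.
rewrite size_mul_eq1 => /andP[/size_poly1P[c c0 ec] _].
by rewrite detf' ec mulrC mul_polyC size_scale.
Qed.
End OverField.

(** * Products of rings *)

Section ProductRing.
Variables (t : nat) (A : 'I_t.+1 -> comNzRingType).
Local Notation R := (prod_ring A).

Definition proj i (x : R) : A i := x i.

Fact proj_is_zmod_morphism i : zmod_morphism (proj i).
Proof. by move=> x y; rewrite /proj !ffunE. Qed.
Fact proj_is_monoid_morphism i : monoid_morphism (proj i).
Proof. by split=> [|x y]; rewrite /proj !ffunE. Qed.
HB.instance Definition _ i :=
  GRing.isZmodMorphism.Build R (A i) (proj i) (proj_is_zmod_morphism i).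
HB.instance Definition _ i :=
  GRing.isMonoidMorphism.Build R (A i) (proj i) (proj_is_monoid_morphism i).

Definition projmx i m n (B : 'M[R]_(m, n)) : 'M[A i]_(m, n) := map_mx (proj i) B.
Definition projpmx i m n (B : 'M[{poly R}]_(m, n)) : 'M[{poly A i}]_(m, n) :=
  map_mx (map_poly (proj i)) B.

Lemma projmx_inj m n (B C : 'M[R]_(m, n)) :
  (forall i, projmx i B = projmx i C) -> B = C.
Proof.
move=> e; apply/matrixP=> a b; apply/ffunP=> i.
by have /matrixP/(_ a b) := e i; rewrite !mxE.
Qed.

Lemma projpmx_inj m n (B C : 'M[{poly R}]_(m, n)) :
  (forall i, projpmx i B = projpmx i C) -> B = C.
Proof.
move=> e; apply/matrixP=> a b; apply/polyP=> d; apply/ffunP=> i.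
by have /matrixP/(_ a b)/polyP/(_ d) := e i; rewrite !mxE !coef_map.
Qed.

Lemma projpmx_cst i m n (B : 'M[R]_(m, n)) : projpmx i (cst B) = cst (projmx i B).
Proof. by apply/matrixP=> a b; rewrite !mxE map_polyC. Qed.

Lemma projpmxM i m n p (B : 'M_(m, n)) (C : 'M_(n, p)) :
  projpmx i (B *m C) = projpmx i B *m projpmx i C.
Proof. exact: map_mxM. Qed.

Lemma projpmx_drop i N m n (B : 'M_(m, n)) :
  projpmx i (dropmx N B) = dropmx N (projpmx i B).
Proof.
apply/matrixP=> a b; rewrite !mxE; apply/polyP=> d.
by rewrite coef_map !coef_drop_poly coef_map.
Qed.

Lemma glue_mx m n (P : forall i, 'M[A i]_(m, n) -> Prop) :
  (forall i, exists M, P i M) -> exists B, forall i, P i (projmx i B).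
Proof.
move=> h; pose M i := projT1 (cid (h i)).
exists (\matrix_(a, b) ([ffun i => M i a b] : R)) => i.
have -> : projmx i (\matrix_(a, b) ([ffun i => M i a b] : R)) = M i.
  by apply/matrixP=> a b; rewrite !mxE /proj ffunE.
exact: (projT2 (cid (h i))).
Qed.

Lemma glue_pmx m n (P : forall i, 'M[{poly A i}]_(m, n) -> Prop) :
  (forall i, exists M, P i M) -> exists B, forall i, P i (projpmx i B).
Proof.
move=> h; pose M i := projT1 (cid (h i)).
pose s a b := (\max_i size (M i a b))%N.
pose B := \matrix_(a, b) \poly_(d < s a b) ([ffun i => (M i a b)`_d] : R).
exists B => i; have -> : projpmx i B = M i; last exact: (projT2 (cid (h i))).
apply/matrixP=> a b; rewrite !mxE; apply/polyP=> d; rewrite coef_map coef_poly.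
case: ltnP => [_|led]; first by rewrite /= /proj ffunE.
rewrite raddf0 nth_default //; apply: leq_trans led.
exact: (leq_bigmax (F := fun i => size (M i a b))).
Qed.

Lemma mx_injective_projmx i m n (B : 'M[R]_(m, n)) :
  mx_injective B -> mx_injective (projmx i B).
Proof.
move=> Binj; apply: mx_injectiveP => x Bx0.
pose M := dfwith (fun j => 0 : 'cV[A j]_n) x.
have [y yM] := glue_mx (fun j => ex_intro (fun z => z = M j) _ erefl).
suff y0 : y = 0.
  by rewrite -[x](dfwith_in (fun j => 0 : 'cV[A j]_n)) -/M -yM y0 [LHS]map_mx0.
apply: mx_injective0 Binj _; apply: projmx_inj => j.
rewrite /projmx map_mxM map_mx0 -!/(projmx _ _) yM /M.
by case: dfwithP => [|j' _]; rewrite ?mulmx0.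
Qed.

Lemma mx_injective_projpmx i m n (B : 'M[{poly R}]_(m, n)) :
  mx_injective B -> mx_injective (projpmx i B).
Proof.
move=> Binj; apply: mx_injectiveP => x Bx0.
pose M := dfwith (fun j => 0 : 'cV[{poly A j}]_n) x.
have [y yM] := glue_pmx (fun j => ex_intro (fun z => z = M j) _ erefl).
suff y0 : y = 0.
  by rewrite -[x](dfwith_in (fun j => 0 : 'cV[{poly A j}]_n)) -/M -yM y0 [LHS]map_mx0.
apply: mx_injective0 Binj _; apply: projpmx_inj => j.
rewrite projpmxM [RHS]map_mx0 yM /M.
by case: dfwithP => [|j' _]; rewrite ?mulmx0.
Qed.

Lemma prod_complemented_injections :
  (forall i, complemented_injections (A i)) -> complemented_injections R.
Proof.
move=> Acompl m k B Binj.
have [C hC] := glue_mx (fun i => Acompl i m k _ (mx_injective_projmx (i := i) Binj)).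
have [P hP] := glue_mx hC; have [Q hQ] := glue_mx hP.
exists C, P, Q; split; apply: projmx_inj => i; have [CB PB PQ e] := hQ i.
- by rewrite /projmx map_mxM map_mx1.
- by rewrite /projmx map_mxM map_mx0.
- by rewrite /projmx map_mxM map_mx1.
- by rewrite /projmx map_mxD !map_mxM map_mx1.
Qed.

Lemma prod_state_basis n k delta (G : 'M[{poly R}]_(n, k)) :
    (forall i, exists X : 'M_(n, delta), state_basis (projpmx i G) X) ->
  exists X : 'M_(n, delta), state_basis G X.
Proof.
move=> /glue_pmx[X Xb]; exists X; split.
- move=> m x B e; apply: projmx_inj => i; rewrite [RHS]map_mx0.
  apply: (state_free (Xb i) (A := projpmx i B)).
  by rewrite -projpmx_cst -!projpmxM e.
- move=> m N B.
  have [x hx] := glue_mx (fun i => state_gen (Xb i) N (projpmx i B)).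
  have [U hU] := glue_pmx hx; exists x, U; apply: projpmx_inj => i.
  rewrite projpmx_drop projpmxM hU /projpmx map_mxD !map_mxM -!/(projpmx _ _).
  by rewrite projpmx_cst.
(* The truncation indices of the factors are raised to their maximum. *)
have /choice[N hN] := fun i => state_drop (Xb i).
pose N0 := (\max_i N i)%N; exists N0.
suff /glue_pmx[V hV] : forall i, exists V, projpmx i X = dropmx N0 (projpmx i G *m V).
  by exists V; apply: projpmx_inj => i; rewrite projpmx_drop projpmxM.
move=> i; have [V ->] := hN i; exists ('X^(N0 - N i) *: V).
have leN : (N i <= N0)%N by apply: leq_bigmax.
by rewrite -scalemxAr -{1}(subnKC leN) -dropmx_drop dropmx_Xn.
Qed.
End ProductRing.

(** * Degrees of codes over a product of fields *)

Section KernelOfProjection.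
Variables (t : nat) (F : 'I_t.+1 -> fieldType).
Local Notation A := (fun i => F i : comNzRingType).
Local Notation R := (prod_ring A).

Definition ker_proj i : {pred R} := fun x => proj i x == 0.

Fact ker_proj_ideal i : idealr_closed (ker_proj i).
Proof.
split; rewrite ?inE /ker_proj -?topredE /= ?rmorph0 ?eqxx //.
  by rewrite rmorph1 oner_eq0.
move=> a u v; rewrite -!topredE /= => /eqP u0 /eqP v0.
by rewrite /ker_proj rmorphD rmorphM /= u0 v0 mulr0 addr0.
Qed.

Fact ker_proj_prime i : prime_idealr_closed (ker_proj i).
Proof.
by move=> u v; rewrite -!topredE /= /ker_proj rmorphM mulf_eq0.
Qed.

HB.instance Definition _ i := isIdealr.Build R (ker_proj i) (ker_proj_ideal i).
HB.instance Definition _ i :=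
  isPrimeIdealrClosed.Build R (ker_proj i) (@ker_proj_prime i).

Definition prime_at i : prime_idealr R := ker_proj i.
End KernelOfProjection.

Section Residue.
Variables (R : comNzRingType) (p : prime_idealr R).

Fact to_residue_is_zmod_morphism : zmod_morphism (to_residue p).
Proof.
move=> a b; rewrite /to_residue.
have -> : (\pi_({ideal_quot p})%qT (a - b) : residue_ring p) =
  (\pi_({ideal_quot p})%qT a : residue_ring p) - \pi_({ideal_quot p})%qT b.
  exact: (rmorphB (\pi_({ideal_quot p})%qT)).
by rewrite rmorphB.
Qed.

Fact to_residue_is_monoid_morphism : monoid_morphism (to_residue p).
Proof.
split=> [|a b]; rewrite /to_residue.
  have -> : (\pi_({ideal_quot p})%qT 1 : residue_ring p) = 1.
    exact: (rmorph1 (\pi_({ideal_quot p})%qT)).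
  by rewrite rmorph1.
have -> : (\pi_({ideal_quot p})%qT (a * b) : residue_ring p) =
  (\pi_({ideal_quot p})%qT a : residue_ring p) * \pi_({ideal_quot p})%qT b.
  exact: (rmorphM (\pi_({ideal_quot p})%qT)).
by rewrite rmorphM.
Qed.
HB.instance Definition _ := GRing.isZmodMorphism.Build R (residue_field p)
  (to_residue p) to_residue_is_zmod_morphism.
HB.instance Definition _ := GRing.isMonoidMorphism.Build R (residue_field p)
  (to_residue p) to_residue_is_monoid_morphism.

Lemma to_residue_eq0 a : (to_residue p a == 0) = (a \in p).
Proof.
rewrite /to_residue tofrac_eq0.
have -> : (0 : residue_ring p) = \pi_({ideal_quot p})%qT 0.
  by rewrite (rmorph0 (\pi_({ideal_quot p})%qT)).
by rewrite -[a in RHS]subr0 Quotient.idealrBE.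
Qed.

(** Conversely to the obvious inclusion, an element of the image is a sum of
    scalar multiples of images of codewords z^d g_j. *)
Lemma code_at_image n k (G : 'M[{poly R}]_(n, k)) (C : {pred 'cV[{poly R}]_n}) w :
  C =i mx_image G ->
  code_at C (p := p) w <-> w \in mx_image (map_mx (map_poly (to_residue p)) G).
Proof.
move=> CG; split=> [[s sC ->] | /asboolP[x ->]].
  elim: s sC => [|[c a] s IHs] sC; first by rewrite big_nil; apply: rpred0.
  rewrite big_cons; apply: rpredD; last first.
    by apply: IHs => y ys; apply: sC; rewrite inE ys orbT.
  have /asboolP[x ->] : c \in mx_image G by rewrite -CG (sC (c, a)) ?mem_head.
  apply/asboolP; exists (a%:P *: map_mx (map_poly (to_residue p)) x).
  by rewrite map_mxM scalemxAr.
pose g j d : 'cV[{poly R}]_n := G *m ('X^d *: delta_mx j 0).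
exists [seq (g jd.1 jd.2, (x jd.1 0)`_jd.2) | jd <-
   [seq (j, d) | j <- enum 'I_k, d <- iota 0 (size (x j 0))]].
  move=> y /mapP[[j d] _ ->] /=; rewrite CG.
  by apply/asboolP; exists ('X^d *: delta_mx j 0).
rewrite big_map big_allpairs_dep big_enum /=.
rewrite {1}[x]matrix_sum_delta mulmx_sumr; apply: eq_bigr => j _; rewrite big_ord1.
rewrite -{1}[x j 0]coefK poly_def scaler_suml mulmx_sumr -(big_mkord xpredT
  (fun d => map_mx _ G *m ((x j 0)`_d *: 'X^d *: delta_mx j 0))).
rewrite /index_iota subn0; apply: eq_bigr => d _.
rewrite /g map_mxM scalemxAr; congr (_ *m _).
apply/matrixP=> a b; rewrite !mxE rmorphM /= map_polyXn.
by rewrite -mul_polyC mulrA rmorph_nat.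
Qed.
End Residue.

(** This makes it possible to compare the degrees of minors over the i-th factor
    and over the residue field at the kernel of the i-th projection, without an
    isomorphism between these fields. *)
Lemma size_map_poly_ker (R S T : nzRingType) (f : {rmorphism R -> S})
    (g : {rmorphism R -> T}) (q : {poly R}) :
  (forall x, (f x == 0) = (g x == 0)) ->
  size (map_poly f q) = size (map_poly g q).
Proof.
move=> fg; apply/eqP; rewrite eqn_leq; apply/andP; split; apply/leq_sizeP => d led;
  rewrite coef_map; apply/eqP; [rewrite fg | rewrite -fg]; rewrite -coef_map;
  by rewrite nth_default.
Qed.

Section ProductOfFields.
Variables (t : nat) (F : 'I_t.+1 -> fieldType).
Local Notation A := (fun i => F i : comNzRingType).
Local Notation R := (prod_ring A).

Lemma constant_degree_proj n k delta (G : 'M[{poly R}]_(n, k))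
    (C : {pred 'cV[{poly R}]_n}) i :
  C =i mx_image G -> constant_degree k C delta ->
  max_minor_degree (projpmx i G : 'M[{poly F i}]_(n, k)) = delta.
Proof.
move=> CG /(_ (prime_at F i))[G' imG' <-].
transitivity (max_minor_degree (map_mx (map_poly (to_residue (prime_at F i))) G)).
  apply: eq_bigr => f _; congr (_.-1).
  rewrite /projpmx -!map_mxsub !det_map_mx; apply: size_map_poly_ker => x.
  by rewrite to_residue_eq0.
apply: max_minor_degree_eq => w.
by apply/idP/idP => [/(code_at_image _ CG)/imG' | /imG'/(code_at_image _ CG)].
Qed.

Lemma prod_field_representations : ring_with_representations R.
Proof.
move=> n k delta C [_ [G Ginj CG] _] Cdeg.
have Rcompl : complemented_injections R.
  by apply: prod_complemented_injections => i; apply: field_complemented_injections.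
have [X Xb] : exists X : 'M_(n, delta), state_basis G X.
  apply: prod_state_basis => i.
  have Giinj := mx_injective_projpmx (i := i) Ginj.
  have [nu [U [U' [UU' red]]]] := exists_column_reduced Giinj.
  have [X Xb] := state_basis_of_reduced red.
  have eX := state_basis_change UU' Xb.
  have e : (\sum_j nu j)%N = delta.
    rewrite -(max_minor_degree_reduced red) -(constant_degree_proj i CG Cdeg).
    apply: max_minor_degree_eq => v; apply/asboolP/asboolP => -[x ->].
      by exists (U *m x); rewrite mulmxA.
    by exists (U' *m x); rewrite -mulmxA (mulmxA U) UU' mul1mx.
  by rewrite -e; exists X.
have to_image K L M : minimal_rep (k := k) (delta := delta) (mx_image G) K L M <->
    minimal_rep (k := k) C K L M.
  by split=> -[rep ? ? ?]; split=> // v; rewrite -rep CG.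
split.
  have [K [L [M KLM]]] := exists_minimal_rep Rcompl Ginj Xb.
  by exists K, L, M; apply/to_image.
move=> K L K' L' M M' /to_image KLM /to_image KLM'.
exact: (minimal_rep_unique Rcompl Xb KLM KLM').
Qed.
End ProductOfFields.

Theorem mainTheorem2 (t : nat) (F : 'I_t.+1 -> finFieldType) :
  ring_with_representations (prod_ring (fun i => F i : comNzRingType)).
Proof. exact: (@prod_field_representations t (fun i => F i : fieldType)). Qed.
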